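(* Let $T$ be a norm on $\mathbf R^3$ with smooth Wulff shape $W=\{T=1\}$ of positive curvature, and let $X:\Sigma\to\mathbf R^3$ be a smooth immersed oriented surface with nowhere vanishing Gauss curvature and Cahn-Hoffman field $\xi$. Let $$\mathcal L[X]=\frac14\int_\Sigma\Bigl(\frac1{\lambda_1}-\frac1{\lambda_2}\Bigr)^2dW$$ be the anisotropic Laguerre functional. Then for every $t\in\mathbf R$ such that the parallel surface $X+t\xi$ is an immersion, $\mathcal L[X+t\xi]=\mathcal L[X]$.
   Context: Let $\nu$ be the unit normal of $X$ such that $dX(e_1),dX(e_2),\nu$ is positively oriented for positively oriented $e_1,e_2$. The Cahn-Hoffman field $\xi:\Sigma\to W$ sends $p$ to the point of $W$ whose outward unit normal is $\nu(p)$. The anisotropic principal curvatures $\lambda_1,\lambda_2$ (real) are defined by $d\xi(e_i)=-\lambda_i\,dX(e_i)$ for a basis $e_1,e_2$ of each tangent space; they are nonzero because the curvature of $X$ does not vanish. $dW$ is the area measure of the pull-back metric $d\xi\cdot d\xi$ on $\Sigma$. The integral takes values in $[0,\infty]$. For $X+t\xi$, the Cahn-Hoffman field, anisotropic principal curvatures and area measure are computed by the same definitions applied to this immersion of $\Sigma$. *)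

(* Defs.v *)
From HB Require Import structures.
From mathcomp Require Import all_boot all_order all_algebra.
From mathcomp Require Import all_classical all_reals all_analysis.

Set Implicit Arguments.
Unset Strict Implicit.
Unset Printing Implicit Defensive.

Import Order.TTheory GRing.Theory Num.Theory.
Import numFieldNormedType.Exports.

Local Open Scope classical_set_scope.
Local Open Scope ring_scope.

(* R^3 is 'rV[R]_3 and R^2 is R * R (which carries both the normed-module and
   the product measurable structure). *)

Section Calculus.
Context {R : realType}.

(* C^k on an open set U: differentiable at every point of U, with all
   directional derivatives of class C^(k-1). *)
Fixpoint Ck_on {V W : normedModType R} (k : nat) (U : set V) (f : V -> W) : Prop :=
  if k is k'.+1 then
    (forall x, U x -> differentiable f x) /\ (forall v, Ck_on k' U ('D_v f))
  else forall x, U x -> {for x, continuous f}.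

Definition smooth_on {V W : normedModType R} (U : set V) (f : V -> W) : Prop :=
  forall k, Ck_on k U f.

Definition dot (u v : 'rV[R]_3) : R := \sum_(i < 3) u 0 i * v 0 i.

(* Indices are taken in Z/3, the ring structure of 'I_3. *)
Definition cross (u v : 'rV[R]_3) : 'rV[R]_3 :=
  \row_(i < 3) (u 0 (i + 1) * v 0 (i + 2) - u 0 (i + 2) * v 0 (i + 1)).

Definition det3 (u v w : 'rV[R]_3) : R := dot (cross u v) w.

Definition det2 (a b : R * R) : R := a.1 * b.2 - a.2 * b.1.

Definition is_norm (T : 'rV[R]_3 -> R) : Prop :=
  [/\ forall u v, T (u + v) <= T u + T v,
      forall (a : R) u, T (a *: u) = `|a| * T u
    & forall u, T u = 0 -> u = 0].

End Calculus.

Section ParametrizedSurfaces.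
Context {R : realType}.
Implicit Types (y : R * R -> 'rV[R]_3) (x : R * R).

Definition immersed_patch (U : set (R * R)) y : Prop :=
  smooth_on U y /\ forall x, U x -> injective ('d y x : R * R -> 'rV[R]_3).

Definition du y : R * R -> 'rV[R]_3 := 'D_((1, 0) : R * R) y.
Definition dv y : R * R -> 'rV[R]_3 := 'D_((0, 1) : R * R) y.

(* EG - F^2, the determinant of the metric dy.dy *)
Definition gram y x : R :=
  dot (du y x) (du y x) * dot (dv y x) (dv y x) - dot (du y x) (dv y x) ^+ 2.

(* sqrt (EG - F^2), the density of the area measure of the metric dy.dy *)
Definition area_density y x : R := Num.sqrt (gram y x).

Definition patch_normal y x : 'rV[R]_3 :=
  let c := cross (du y x) (dv y x) in (Num.sqrt (dot c c))^-1 *: c.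

(* (LN - M^2) / (EG - F^2) *)
Definition gauss_curvature y x : R :=
  let n := patch_normal y x in
  (dot (du (du y) x) n * dot (dv (dv y) x) n - dot (dv (du y) x) n ^+ 2)
  / gram y x.

End ParametrizedSurfaces.

Section EmbeddedSurfaces.
Context {R : realType}.
Implicit Types (M : set 'rV[R]_3) (y : R * R -> 'rV[R]_3) (w v n : 'rV[R]_3).

(* y is a regular local parametrization of M: an injective immersion of U
   which is a homeomorphism onto a relatively open subset of M. *)
Definition local_param M (U : set (R * R)) y : Prop :=
  [/\ open U, immersed_patch U y, set_inj U y
    & forall U', open U' -> U' `<=` U ->
        exists2 V, open V & y @` U' = M `&` V].

Definition smooth_surface M : Prop :=
  forall w, M w -> exists U y, local_param M U y /\ (y @` U) w.

Definition positive_curvature M : Prop :=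
  forall U y, local_param M U y -> forall x, U x -> 0 < gauss_curvature y x.

Definition tangent_vector M w v : Prop :=
  exists U y x, [/\ local_param M U y, U x, y x = w & exists e, v = 'd y x e].

Definition wulff_shape (T : 'rV[R]_3 -> R) : set 'rV[R]_3 := [set w | T w = 1].

(* n is a unit normal of W = {T = 1} at w pointing out of {T <= 1} *)
Definition outward_unit_normal (T : 'rV[R]_3 -> R) w n : Prop :=
  [/\ dot n n = 1,
      forall v, tangent_vector (wulff_shape T) w v -> dot n v = 0
    & \forall s \near 0^'+, 1 < T (w + s *: n)].

End EmbeddedSurfaces.

(* A smooth oriented surface: a Hausdorff space with a countable atlas (i.e.
   second countable) of charts with smooth, orientation-preserving transition
   maps. The k-th chart is given by its parametrization [param k], defined on
   the open set [dom k] of R^2, and the inverse coordinate map [coord k],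
   defined on [param k @` dom k]; the values outside are irrelevant. *)
Record oriented_surface (R : realType) := OrientedSurface {
  carrier :> topologicalType;
  dom : nat -> set (R * R);
  param : nat -> R * R -> carrier;
  coord : nat -> carrier -> R * R;
  surface_hausdorff : hausdorff_space carrier;
  dom_open : forall k, open (dom k);
  image_open : forall k, open (param k @` dom k);
  param_continuous : forall k x, dom k x -> {for x, continuous (param k)};
  coord_continuous : forall k p, (param k @` dom k) p ->
    {for p, continuous (coord k)};
  paramK : forall k x, dom k x -> coord k (param k x) = x;
  charts_cover : forall p, exists k, (param k @` dom k) p;
  transition_smooth : forall j k,
    smooth_on (dom k `&` param k @^-1` (param j @` dom j))
              (coord j \o param k);
  transition_oriented : forall j k x,
    dom k x -> (param j @` dom j) (param k x) ->
    0 < det2 ('D_((1, 0) : R * R) (coord j \o param k) x)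
             ('D_((0, 1) : R * R) (coord j \o param k) x)
}.

Section ImmersedSurfaces.
Context {R : realType} {S : oriented_surface R}.
Implicit Types (F X : S -> 'rV[R]_3) (T : 'rV[R]_3 -> R) (p : S).

Definition immersion X : Prop :=
  forall k, immersed_patch (dom S k) (X \o param S k).

Definition nonvanishing_gauss_curvature X : Prop :=
  forall k x, dom S k x -> gauss_curvature (X \o param S k) x != 0.

(* A tangent vector of S at [param k x] is represented in the k-th chart by
   e : R * R; its image under dX is then ['d (X \o param k) x e]. *)
Definition is_unit_normal X p (n : 'rV[R]_3) : Prop :=
  dot n n = 1 /\
  forall k x, dom S k x -> param S k x = p ->
    let dX : R * R -> 'rV[R]_3 := 'd (X \o param S k) x in
    (forall e, dot n (dX e) = 0) /\
    (forall e1 e2, 0 < det2 e1 e2 -> 0 < det3 (dX e1) (dX e2) n).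

Definition unit_normal X p : 'rV[R]_3 := xget 0 [set n | is_unit_normal X p n].

Definition cahn_hoffman T X p : 'rV[R]_3 :=
  xget 0 [set w | wulff_shape T w /\ outward_unit_normal T w (unit_normal X p)].

Definition is_anisotropic_principal_curvatures T X p (l : R * R) : Prop :=
  exists k x, [/\ dom S k x, param S k x = p &
    let dX : R * R -> 'rV[R]_3 := 'd (X \o param S k) x in
    let dxi : R * R -> 'rV[R]_3 := 'd (cahn_hoffman T X \o param S k) x in
    exists e1 e2, [/\ det2 e1 e2 != 0,
      dxi e1 = - l.1 *: dX e1 & dxi e2 = - l.2 *: dX e2]].

(* (lambda_1, lambda_2), which is determined up to order *)
Definition anisotropic_principal_curvatures T X p : R * R :=
  xget (0, 0) [set l | is_anisotropic_principal_curvatures T X p l].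

(* The part of the k-th chart not covered by the previous charts; the images
   of these sets partition S. *)
Definition chart_piece (k : nat) : set (R * R) :=
  [set x | dom S k x /\
           forall j, (j < k)%N -> ~ (param S j @` dom S j) (param S k x)].

(* The integral of f >= 0 against the area measure of the pull-back metric
   dF.dF on S, computed in the charts. *)
Definition area_integral F (f : S -> R) : \bar R :=
  (\sum_(0 <= k <oo)
     \int[lebesgue_measure \x lebesgue_measure]_(x in chart_piece k)
       (f (param S k x) * area_density (F \o param S k) x)%:E)%E.

Definition laguerre T X : \bar R :=
  ((4^-1)%:E * area_integral (cahn_hoffman T X) (fun p =>
     let l := anisotropic_principal_curvatures T X p in
     (((l.1)^-1 - (l.2)^-1) ^+ 2)%R))%E.

Definition parallel_surface T X (t : R) : S -> 'rV[R]_3 :=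
  fun p => X p + t *: cahn_hoffman T X p.

End ImmersedSurfaces.

(* Main.v *)
Require Import Defs.
From mathcomp Require Import all_boot all_order all_algebra.
From mathcomp Require Import all_classical all_reals all_analysis.
From mathcomp Require Import ring lra.
Import Order.TTheory GRing.Theory Num.Theory.
Import numFieldNormedType.Exports.
Local Open Scope classical_set_scope.
Local Open Scope ring_scope.
Set Implicit Arguments.
Unset Strict Implicit.
Unset Printing Implicit Defensive.

(* If d xi (e_i) = - lambda_i dX (e_i), then
   d(X + t xi)(e_i) = (1 - t lambda_i) dX (e_i), so the tangent planes of X and
   X + t xi coincide and their unit normals agree up to a sign s, which is locally
   constant. Since W is centrally symmetric, the Cahn-Hoffman field becomes s xi,
   its area measure is unchanged, and 1 / lambda_i becomes s (1 / lambda_i - t);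
   hence the integrand is pointwise invariant.

   The sign s = -1 requires the point of W with a given outward normal n to be
   unique. Such a point maximizes <n, .> on {T <= 1}; two maximizers would be
   joined by a segment contained in W, whereas positive curvature makes each of
   them an isolated point of the level set of <n, .> in W.

   Neither the smoothness of xi nor the existence of the lambda_i need be derived
   from those of W: for t != 0 the field xi = ((X + t xi) - X) / t is smooth in
   every chart; where xi is an immersion, real lambda_i exist for X exactly when
   they do for X + t xi, and elsewhere the area density vanishes. *)

(** * Vectors in R^3 *)

Section Vectors.
Context {R : realType}.
Implicit Types (u v w a b n : 'rV[R]_3) (k : R).

Lemma row3P u v : u 0 0 = v 0 0 -> u 0 1 = v 0 1 -> u 0 2 = v 0 2 -> u = v.
Proof.
move=> h0 h1 h2; apply/rowP => -[[|[|[|//]]]] i.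
- by rewrite (_ : Ordinal i = 0) //; apply: val_inj.
- by rewrite (_ : Ordinal i = 1) //; apply: val_inj.
- by rewrite (_ : Ordinal i = 2) //; apply: val_inj.
Qed.

Lemma dotE u v : dot u v = u 0 0 * v 0 0 + u 0 1 * v 0 1 + u 0 2 * v 0 2.
Proof.
rewrite /dot !big_ord_recl big_ord0 addr0 addrA.
by congr (_ + u 0 _ * v 0 _ + u 0 _ * v 0 _); apply: val_inj.
Qed.

Lemma crossE u v :
  (cross u v 0 0 = u 0 1 * v 0 2 - u 0 2 * v 0 1) *
  (cross u v 0 1 = u 0 2 * v 0 0 - u 0 0 * v 0 2) *
  (cross u v 0 2 = u 0 0 * v 0 1 - u 0 1 * v 0 0).
Proof.
rewrite /cross !mxE.
by do ![split]; congr (u 0 _ * v 0 _ - u 0 _ * v 0 _); apply: val_inj.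
Qed.

Lemma entryD u v (i : 'I_3) : (u + v) 0 i = u 0 i + v 0 i.
Proof. by rewrite mxE. Qed.

Lemma entryN u (i : 'I_3) : (- u) 0 i = - u 0 i.
Proof. by rewrite mxE. Qed.

Lemma entryZ k u (i : 'I_3) : (k *: u) 0 i = k * u 0 i.
Proof. by rewrite mxE. Qed.

Lemma entry0 (i : 'I_3) : (0 : 'rV[R]_3) 0 i = 0.
Proof. by rewrite mxE. Qed.

Definition entryE := (entryD, entryN, entryZ, entry0).

End Vectors.

Ltac row_ring := apply: row3P; rewrite ?(entryE, crossE, dotE); ring.

Section DotCross.
Context {R : realType}.
Implicit Types (u v w a b n : 'rV[R]_3) (k : R).

Lemma dotC u v : dot u v = dot v u.
Proof. by rewrite !dotE; ring. Qed.

Lemma dotDr u v w : dot u (v + w) = dot u v + dot u w.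
Proof. by rewrite !dotE !entryE; ring. Qed.

Lemma dotZr k u v : dot u (k *: v) = k * dot u v.
Proof. by rewrite !dotE !entryE; ring. Qed.

Lemma dotNr u v : dot u (- v) = - dot u v.
Proof. by rewrite !dotE !entryE; ring. Qed.

Lemma dotBr u v w : dot u (v - w) = dot u v - dot u w.
Proof. by rewrite dotDr dotNr. Qed.

Lemma dot0r u : dot u 0 = 0.
Proof. by rewrite !dotE !entryE; ring. Qed.

Lemma dotZl k u v : dot (k *: u) v = k * dot u v.
Proof. by rewrite dotC dotZr dotC. Qed.

Lemma dotNl u v : dot (- u) v = - dot u v.
Proof. by rewrite dotC dotNr dotC. Qed.

Lemma dot0l u : dot 0 u = 0.
Proof. by rewrite dotC dot0r. Qed.

Lemma dot_ge0 u : 0 <= dot u u.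
Proof. by rewrite dotE; nra. Qed.

Lemma dot_eq0 u : (dot u u == 0) = (u == 0).
Proof.
apply/eqP/eqP => [|->]; last exact: dot0l.
by rewrite dotE => h; apply: row3P; rewrite entryE; nra.
Qed.

Lemma dot_crossl u v : dot (cross u v) u = 0.
Proof. by rewrite dotE !crossE; ring. Qed.

Lemma dot_crossr u v : dot (cross u v) v = 0.
Proof. by rewrite dotE !crossE; ring. Qed.

Lemma lagrange_identity u v :
  dot (cross u v) (cross u v) = dot u u * dot v v - dot u v ^+ 2.
Proof. by rewrite !dotE !crossE; ring. Qed.

Lemma cross0l u : cross 0 u = 0.
Proof. row_ring. Qed.

Lemma cross_cross u v :
  cross (cross u v) u = (- dot u v) *: u + dot u u *: v.
Proof. row_ring. Qed.

Lemma crossZl k u v : cross (k *: u) v = k *: cross u v.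
Proof. row_ring. Qed.

Lemma crossZr k u v : cross u (k *: v) = k *: cross u v.
Proof. row_ring. Qed.

Lemma crossZZ (k l : R) u v : cross (k *: u) (l *: v) = (k * l) *: cross u v.
Proof. row_ring. Qed.

Lemma cross_comb a b (e1 e2 : R * R) :
  cross (e1.1 *: a + e1.2 *: b) (e2.1 *: a + e2.2 *: b) =
  det2 e1 e2 *: cross a b.
Proof. by rewrite /det2; row_ring. Qed.

(** Polarization of [cross_comb], which is quadratic in the pair [(a, b)]. It yields the trace
    identity in [eigenvalues_sum]. *)
Lemma cross_comb2 a b a' b' (e1 e2 : R * R) :
  cross (e1.1 *: a + e1.2 *: b) (e2.1 *: a' + e2.2 *: b') +
  cross (e1.1 *: a' + e1.2 *: b') (e2.1 *: a + e2.2 *: b) =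
  det2 e1 e2 *: (cross a b' + cross a' b).
Proof. by rewrite /det2; row_ring. Qed.

(** Cramer's rule for the frame [c, a, b]: the coefficients along [a] and [b] solve a system with
    the Gram matrix of [a, b], whose determinant is [dot c c]. *)
Lemma cross_frame a b v : let c := cross a b in
  dot c c *: v = dot v c *: c
    + (dot v a * dot b b - dot v b * dot a b) *: a
    + (dot v b * dot a a - dot v a * dot a b) *: b.
Proof. by rewrite /=; row_ring. Qed.

Lemma perp_parallel_cross a b n : cross a b != 0 ->
  dot n a = 0 -> dot n b = 0 ->
  n = (dot n (cross a b) / dot (cross a b) (cross a b)) *: cross a b.
Proof.
rewrite -dot_eq0 => c0 na nb; have := cross_frame a b n.
rewrite /= na nb !mul0r subrr !scale0r !addr0 => h.
by rewrite mulrC -scalerA -h scalerA mulVf // scale1r.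
Qed.

Lemma perp_span a b n v : cross a b != 0 -> n != 0 ->
  dot n a = 0 -> dot n b = 0 -> dot n v = 0 ->
  exists e : R * R, v = e.1 *: a + e.2 *: b.
Proof.
move=> c0 n0 na nb nv; have nE := perp_parallel_cross c0 na nb.
have k0 : dot n (cross a b) / dot (cross a b) (cross a b) != 0.
  by apply: contraNneq n0 => k0; rewrite nE k0 scale0r.
move: nv; rewrite nE dotZl => /eqP; rewrite mulf_eq0 (negbTE k0) /= => /eqP cv.
have := cross_frame a b v; rewrite /= (dotC v (cross a b)) cv scale0r add0r => h.
move: c0; rewrite -dot_eq0 => c0.
exists ((dot v a * dot b b - dot v b * dot a b) / dot (cross a b) (cross a b),
        (dot v b * dot a a - dot v a * dot a b) / dot (cross a b) (cross a b)).
rewrite /= ![_ / _]mulrC -!scalerA -scalerDr -h scalerA mulVf ?scale1r //.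
Qed.

End DotCross.

(** * Differential calculus *)

Section Calculus.
Context {R : realType}.

(** Both sides have the same difference quotients. This reduces directional derivatives to
    derivatives of curves. *)
Lemma is_derive_along_line (V W : normedModType R) (f : V -> W) (x v : V) (s : R)
    (df : W) :
  is_derive s 1 (fun h : R => f (h *: v + x)) df <-> is_derive (s *: v + x) v f df.
Proof.
have qE (h : R) : h^-1 *: (((fun h : R => f (h *: v + x)) \o shift s) (h *: 1)
      - f (s *: v + x)) = h^-1 *: ((f \o shift (s *: v + x)) (h *: v) - f (s *: v + x)).
  by rewrite /= [_%:A]mulr1 scalerDl addrA.
have dE : derivable (fun h : R => f (h *: v + x)) s 1 = derivable f (s *: v + x) v.
  rewrite /derivable; set g1 := fun h => h^-1 *: _; set g2 := fun h => h^-1 *: _.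
  by have -> : g1 = g2 by apply: funext => h; exact: qE.
have DE : 'D_1 (fun h : R => f (h *: v + x)) s = 'D_v f (s *: v + x).
  rewrite /derive; set g1 := fun h => h^-1 *: _; set g2 := fun h => h^-1 *: _.
  by have -> : g1 = g2 by apply: funext => h; exact: qE.
by split=> -[dv Dv]; apply: DeriveDef; rewrite ?dE ?DE // -?dE -?DE.
Qed.

Lemma is_derive_line (V W : normedModType R) (f : V -> W) (x v : V) (df : W) :
  is_derive (0 : R) 1 (fun h : R => f (h *: v + x)) df <-> is_derive x v f df.
Proof. by rewrite is_derive_along_line scale0r add0r. Qed.

Lemma is_derive_diff (V W : normedModType R) (f : V -> W) (x v : V) :
  differentiable f x -> is_derive x v f ('d f x v).
Proof. by move=> df; apply: DeriveDef; [exact: diff_derivable|exact: deriveE]. Qed.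

Lemma is_derive_diff_line (V W : normedModType R) (f : V -> W) (x v : V) :
  differentiable f x -> is_derive (0 : R) 1 (fun h : R => f (h *: v + x)) ('d f x v).
Proof. by move=> df; apply/is_derive_line/is_derive_diff. Qed.

Lemma near_eq_differentiable (V W : normedModType R) (f g : V -> W) (x : V) :
  (\forall z \near x, f z = g z) -> differentiable f x -> differentiable g x.
Proof.
move=> fg df; have [dc /eqaddoP dfe] := (diff_locallyP x f).1 df.
have fgx : f x = g x := nbhs_singleton fg.
have gE : g \o shift x = cst (g x) + 'd f x +o_ 0 id.
  apply/eqaddoP => e e0; move: fg; rewrite (near_shift 0 x) subr0 => fg.
  apply: filterS2 fg (dfe e e0) => h /= fgh.
  by rewrite !fctE /= fgh fgx.
have dE := diff_unique dc gE.
by apply/diff_locallyP; rewrite dE.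
Qed.

(** Chain rule for a factorization that holds only near [x], as it does for chart changes. *)
Lemma diff_near_comp (V W Z : normedModType R) (f : V -> Z) (g : W -> Z)
    (h : V -> W) (x v : V) :
  differentiable f x -> differentiable h x -> differentiable g (h x) ->
  (\forall z \near x, f z = g (h z)) -> 'd f x v = 'd g (h x) ('d h x v).
Proof.
move=> df dh dg fgh; have := congr1 (@^~ v) (diff_comp dh dg) => /= <-.
have dgh : differentiable (g \o h) x := differentiable_comp dh dg.
apply: etrans (esym (deriveE v df)) _.
exact: etrans (@near_eq_derive _ _ _ f (g \o h) x v fgh) (deriveE v dgh).
Qed.

Lemma near_line (V : normedModType R) (U : set V) (x v : V) : open U -> U x ->
  \forall s \near (0 : R), U (s *: v + x).
Proof.
move=> oU Ux; have lc : {for (0 : R), continuous (fun s : R => s *: v + x)}.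
  apply: differentiable_continuous; apply: differentiableD => //.
apply: lc; rewrite scale0r add0r; exact: open_nbhs_nbhs.
Qed.

Lemma is_derive_rowP (V : normedModType R) (c : V -> 'rV[R]_3) (x v : V)
    (dc : 'rV[R]_3) :
  is_derive x v c dc <->
  forall i, is_derive x v (fun s => c s 0 i) (dc 0 i).
Proof.
split=> [[dv E] i|dci].
  apply: DeriveDef; first exact: (derivable_mxP c x v).1.
  by rewrite -E derive_mx // mxE.
have dv : derivable c x v.
  by apply/derivable_mxP => i j; rewrite ord1; case: (dci j).
apply: DeriveDef => //; rewrite derive_mx //; apply/rowP => i.
by rewrite mxE; case: (dci i).
Qed.

Lemma is_derive_dot (V : normedModType R) (n : 'rV[R]_3) (c : V -> 'rV[R]_3)
    (x v : V) (dc : 'rV[R]_3) :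
  is_derive x v c dc -> is_derive x v (fun s => dot n (c s)) (dot n dc).
Proof.
move=> /is_derive_rowP dci.
have -> : (fun s => dot n (c s)) =
    (fun s => n 0 0 *: c s 0 0 + n 0 1 *: c s 0 1 + n 0 2 *: c s 0 2).
  by apply: funext => s; rewrite dotE.
by rewrite dotE -![_ * dc _ _]/(_ *: _); apply: is_deriveD.
Qed.

Lemma is_derive_scale (V : normedModType R) (k : V -> R) (c : V -> 'rV[R]_3)
    (x v : V) (dk : R) (dc : 'rV[R]_3) :
  is_derive x v k dk -> is_derive x v c dc ->
  is_derive x v (fun s => k s *: c s) (dk *: c x + k x *: dc).
Proof.
move=> dkx /is_derive_rowP dci; apply/is_derive_rowP => i.
have -> : (fun s => (k s *: c s) 0 i) = k * (fun s => c s 0 i).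
  by apply: funext => s; rewrite entryZ.
apply: is_derive_eq; rewrite !entryE addrC; congr (_ + _).
by rewrite -[LHS]/(_ * _) mulrC.
Qed.

Lemma differentiable_dot (V : normedModType R) (c c' : V -> 'rV[R]_3) (x : V) :
  differentiable c x -> differentiable c' x ->
  differentiable (fun s => dot (c s) (c' s)) x.
Proof.
move=> dc dc'.
have di (b : V -> 'rV[R]_3) (i : 'I_3) : differentiable b x ->
    differentiable (fun s => b s 0 i) x.
  move=> db; apply: (@differentiable_comp _ _ _ _ b (fun N => N 0 i)) => //.
  exact: differentiable_coord.
have -> : (fun s => dot (c s) (c' s)) = (fun s => c s 0 0 * c' s 0 0) +
    (fun s => c s 0 1 * c' s 0 1) + (fun s => c s 0 2 * c' s 0 2).
  by apply: funext => s; rewrite dotE.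
by apply: differentiableD; [apply: differentiableD|]; apply: differentiableM;
  apply: di.
Qed.

(** The derivative is also the limit of the quotients with positive increment, so a one-sided
    maximum fixes its sign. *)
Lemma derive_le0_at_right (g : R -> R) (d : R) :
  (\forall s \near 0^'+, g s <= g 0) -> is_derive (0 : R) 1 g d -> d <= 0.
Proof.
move=> gle [dg <-]; rewrite ['D_1 g _]cvg_at_rightE //.
apply: limr_le.
  rewrite -(cvg_at_rightE (fun h : R => h^-1 *: ((g \o shift 0) _ - g 0))) //.
  apply: cvg_trans dg; apply: cvg_app => A [e egt0 Ae].
  by exists e => // x xe xgt0; apply: Ae => //; exact/lt0r_neq0.
near=> h; rewrite /= addr0 [h%:A]mulr1 pmulr_rle0 ?invr_gt0 // ?subr_le0; near: h.
exact: gle.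
Unshelve. all: by end_near. Qed.

Lemma derive_ge0_at_right (g : R -> R) (d : R) :
  (\forall s \near 0^'+, g 0 <= g s) -> is_derive (0 : R) 1 g d -> 0 <= d.
Proof.
move=> gge dg; rewrite -oppr_le0; apply: (@derive_le0_at_right (- g)).
by apply: filterS gge => s; rewrite lerN2.
Qed.

End Calculus.

(** * Norms on R^3: Lipschitz continuity and derivatives along curves *)

Section Norms.
Context {R : realType} (T : 'rV[R]_3 -> R) (T_norm : is_norm T).
Implicit Types (u v : 'rV[R]_3).

Lemma is_normD u v : T (u + v) <= T u + T v.
Proof. by case: T_norm. Qed.

Lemma is_normZ (a : R) u : T (a *: u) = `|a| * T u.
Proof. by case: T_norm. Qed.

Lemma is_norm_eq0 u : T u = 0 -> u = 0.
Proof. by case: T_norm => _ _; apply. Qed.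

Lemma is_norm0 : T 0 = 0.
Proof. by rewrite -(scale0r 0) is_normZ normr0 mul0r. Qed.

Lemma is_normN u : T (- u) = T u.
Proof. by rewrite -scaleN1r is_normZ normrN1 mul1r. Qed.

Lemma is_norm_ge0 u : 0 <= T u.
Proof. by have := is_normD u (- u); rewrite subrr is_norm0 is_normN; lra. Qed.

(** Expanding [u] in the standard basis bounds [T u] by a multiple of the sup norm; the triangle
    inequality then bounds differences. *)
Lemma is_norm_lipschitz : exists2 C : R, 0 < C &
  forall u v, `|T u - T v| <= C * `|u - v|.
Proof.
pose e (i : 'I_3) : 'rV[R]_3 := delta_mx 0 i.
(* The summand 1 makes [C] positive as soon as [T] is nonnegative. *)
pose C := T (e 0) + T (e 1) + T (e 2) + 1.
have C0 : 0 < C.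
  by rewrite /C; have := is_norm_ge0 (e 0); have := is_norm_ge0 (e 1);
    have := is_norm_ge0 (e 2); lra.
have TC u : T u <= C * `|u|.
  have -> : T u = T (u 0 0 *: e 0 + u 0 1 *: e 1 + u 0 2 *: e 2).
    congr T; apply: row3P; rewrite !mxE !eqxx /=; ring.
  have ui (i : 'I_3) : `|u 0 i| * T (e i) <= `|u| * T (e i).
    apply: ler_wpM2r; first exact: is_norm_ge0.
    rewrite [leRHS]/Num.Def.normr /= mx_normrE.
    exact: (le_bigmax _ (fun ij => `|u ij.1 ij.2|) (0, i)).
  apply: (le_trans (is_normD _ _)); rewrite is_normZ.
  apply: (@le_trans _ _ (`|u 0 0| * T (e 0) + `|u 0 1| * T (e 1) + `|u 0 2| * T (e 2))).
    by rewrite lerD2r -!is_normZ; exact: is_normD.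
  by have := ui 0; have := ui 1; have := ui 2; have := normr_ge0 u; rewrite /C; nra.
exists C => // u v; rewrite ler_norml; apply/andP; split.
  have := is_normD (v - u) u; rewrite subrK => h.
  by have := TC (v - u); rewrite distrC; lra.
have := is_normD (u - v) v; rewrite subrK => h.
by have := TC (u - v); lra.
Qed.

Lemma is_norm_continuous : continuous T.
Proof.
have [C C0 TL] := is_norm_lipschitz => u.
apply/(@cvgrPdist_le _ _ _ (nbhs u) (nbhs_filter u) T (T u)) => e e0.
apply/nbhs_ballP; exists (e / C); first exact: divr_gt0.
move=> v; rewrite -ball_normE /= => uv; apply: (le_trans (TL _ _)).
by rewrite -ler_pdivlMl // mulrC ltW.
Qed.

(** Curves tangent at 0 differ by o(h), and by the Lipschitz bound so do their images under [T].
    Hence the derivative of [T] along a curve may be computed on any tangent curve. *)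
Lemma is_derive_norm_tangent (c c' : R -> 'rV[R]_3) (v : 'rV[R]_3) (d : R) :
  c 0 = c' 0 -> is_derive (0 : R) 1 c v -> is_derive (0 : R) 1 c' v ->
  is_derive (0 : R) 1 (T \o c) d -> is_derive (0 : R) 1 (T \o c') d.
Proof.
move=> c0 dc dc' dTc; have [C C0 TL] := is_norm_lipschitz.
pose g (h : R) : R := T (c' h) - T (c h).
suff dg : is_derive (0 : R) 1 g 0.
  have -> : T \o c' = g + (T \o c) by apply: funext => h; rewrite !fctE subrK.
  by apply: is_derive_eq; rewrite add0r.
have [+ Dcc] : is_derive (0 : R) 1 (c' - c) 0 by apply: is_derive_eq; rewrite subrr.
rewrite /derivable -[X in _ --> X]/('D_1 (c' - c) 0) Dcc => dcc.
suff h : h^-1 *: ((g \o shift 0) (h *: 1) - g 0) @[h --> (0 : R)^'] --> (0 : R).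
  by apply: DeriveDef; [exact: cvgP h|exact: cvg_lim h].
apply/cvgrPdist_le => e e0.
have /cvgrPdist_le /(_ (e / C) (divr_gt0 e0 C0)) := dcc.
apply: filterS => h /=.
rewrite !sub0r !normrN !normrZ !fctE /= /g !c0 !subrr !subr0 => hle.
have := TL (c' (h *: 1 + 0)) (c (h *: 1 + 0)) => hT.
rewrite -(ler_pM2l C0) mulrCA [C * (e / C)]mulrCA mulfV ?gt_eqF // mulr1 in hle.
apply: le_trans hle; apply: ler_wpM2l => //.
Qed.

End Norms.

(** * Patches and the derivative of the norm *)

Section Patches.
Context {R : realType}.
Implicit Types (U : set (R * R)) (y : R * R -> 'rV[R]_3) (x e : R * R).

Lemma pair_coords (e : R * R) :
  e = e.1 *: ((1, 0) : R * R) + e.2 *: ((0, 1) : R * R).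
Proof.
case: e => a b; rewrite -[RHS]/(a * 1 + b * 0, a * 0 + b * 1).
by rewrite !mulr1 !mulr0 addr0 add0r.
Qed.

Lemma diff_coords y x e : differentiable y x ->
  'd y x e = e.1 *: du y x + e.2 *: dv y x.
Proof.
by move=> dy; rewrite /du /dv !deriveE // -!linearZ -linearD -pair_coords.
Qed.

Lemma immersed_patch_differentiable U y x : immersed_patch U y -> U x ->
  [/\ differentiable y x, differentiable (du y) x & differentiable (dv y) x].
Proof.
move=> [/(_ 2%N) [dy d2y] _] Ux; split; first exact: dy.
  exact: (d2y _).1.
exact: (d2y _).1.
Qed.

(** With [a], [b] the partial derivatives, a x b = 0 gives 0 = (a x b) x a = -(a.b) a + (a.a) b.
    Injectivity then forces a.a = 0, so a = 0 and [(1, 0)] lies in the kernel, a contradiction. *)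
Lemma immersed_patch_cross U y x : immersed_patch U y -> U x ->
  cross (du y x) (dv y x) != 0.
Proof.
move=> Uy Ux; have [dy _ _] := immersed_patch_differentiable Uy Ux.
have inj : forall e, 'd y x e = 0 -> e = 0.
  by move=> e e0; apply: (Uy.2 x Ux); rewrite linear0.
apply/eqP => c0; have := @cross_cross R (du y x) (dv y x).
rewrite c0 cross0l.
move: (du y x) (dv y x) (fun e => @diff_coords y x e dy) => a b dyE h.
have /inj [_ aa0] : 'd y x (- dot a b, dot a a) = 0 by rewrite dyE -h.
have /inj [/eqP] : 'd y x (1, 0) = 0.
  by rewrite dyE scale0r scale1r addr0; apply/eqP; rewrite -dot_eq0 aa0.
by rewrite oner_eq0.
Qed.

End Patches.

Section WulffShape.
Context {R : realType} (T : 'rV[R]_3 -> R) (T_norm : is_norm T).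
Implicit Types (u v w n : 'rV[R]_3) (U : set (R * R)) (y : R * R -> 'rV[R]_3).

Lemma local_param_differentiable M U y x : local_param M U y -> U x ->
  differentiable y x.
Proof.
by move=> [_ Uy _ _] Ux; have [] := immersed_patch_differentiable Uy Ux.
Qed.

Lemma local_param_mem M U y x : local_param M U y -> U x -> M (y x).
Proof.
move=> [oU _ _ /(_ U oU) []] // V _ UV Ux.
by have [] : (M `&` V) (y x) by rewrite -UV; exists x.
Qed.

(** The curve [c] is tangent to (1 + b s) y(x + s e), along which [T] equals 1 + b s for small s
    because [y] takes values in {T = 1}. *)
Lemma is_derive_norm_local_param U y x e (b : R) (c : R -> 'rV[R]_3) :
  local_param (wulff_shape T) U y -> U x -> c 0 = y x ->
  is_derive (0 : R) 1 c ('d y x e + b *: y x) ->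
  is_derive (0 : R) 1 (T \o c) b.
Proof.
move=> Wy Ux c0; have dy := local_param_differentiable Wy Ux.
pose k (s : R) : R := 1 + b * s.
have dk : is_derive (0 : R) 1 k b.
  have -> : k = cst 1 + b *: id by apply: funext.
  have d1 : is_derive (0 : R) 1 (cst 1 : R -> R) 0 by exact: is_derive_cst.
  have d2 : is_derive (0 : R) 1 (b *: id : R -> R) (b *: 1).
    by apply: is_deriveZ.
  have := is_deriveD d1 d2; rewrite add0r.
  by rewrite -[b *: 1]/(b * 1) mulr1.
pose c1 (s : R) := k s *: y (s *: e + x).
have dc1 : is_derive (0 : R) 1 c1 ('d y x e + b *: y x).
  have dl := is_derive_diff_line e dy; have := is_derive_scale dk dl.
  by rewrite /k mulr0 addr0 scale1r scale0r add0r addrC.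
have c10 : c1 0 = c 0 by rewrite /c1 /k mulr0 addr0 scale1r scale0r add0r c0.
have ck : {for (0 : R), continuous k}.
  by apply/differentiable_continuous/derivable1_diffP; case: dk.
move=> dc; apply: (is_derive_norm_tangent T_norm c10 dc1 dc).
apply: near_eq_is_derive dk; near=> s.
rewrite /c1 /= (is_normZ T_norm) (_ : T (y _) = 1) ?mulr1.
  rewrite gtr0_norm //; near: s.
  by apply: (cvgr_gt _ ck); rewrite /k mulr0 addr0.
apply: (local_param_mem Wy); near: s.
by apply: near_line => //; case: Wy.
Unshelve. all: by end_near. Qed.

End WulffShape.

(** * Outward normals and support points *)

Section OutwardNormal.
Context {R : realType} (T : 'rV[R]_3 -> R) (T_norm : is_norm T).
Implicit Types (u v w n : 'rV[R]_3) (U : set (R * R)) (y : R * R -> 'rV[R]_3).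

(** Write w for [y x]. The tangent plane is the orthogonal complement of [n]; [T] has derivative 0
    along it and 1 along w, so dT(v) = <n, v> / <n, w>. *)
Lemma is_derive_norm_normal U y x n :
  local_param (wulff_shape T) U y -> U x -> n != 0 ->
  (forall e, dot n ('d y x e) = 0) ->
  dot n (y x) != 0 /\
  forall (c : R -> 'rV[R]_3) v, c 0 = y x -> is_derive (0 : R) 1 c v ->
    is_derive (0 : R) 1 (T \o c) (dot n v / dot n (y x)).
Proof.
move=> Wy Ux n0 ndy; have dy := local_param_differentiable Wy Ux.
have cross0 : cross (du y x) (dv y x) != 0.
  by case: Wy => _ Uy _ _; exact: immersed_patch_cross Uy Ux.
have nu : dot n (du y x) = 0.
  by rewrite -(ndy (1, 0)) diff_coords //= scale1r scale0r addr0.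
have nv : dot n (dv y x) = 0.
  by rewrite -(ndy (0, 1)) diff_coords //= scale1r scale0r add0r.
have tangent v : dot n v = 0 -> exists e, v = 'd y x e.
  move=> /(perp_span cross0 n0 nu nv)[e ->].
  by exists e; rewrite diff_coords.
have nw : dot n (y x) != 0.
  (* If w were tangent, the velocity 0 of the constant curve at w could be written as dy(-e) + w,
     and [T] would have both derivatives 1 and 0 along it. *)
  apply/eqP => /tangent[e wE].
  have dc : is_derive (0 : R) 1 (cst (y x) : R -> 'rV[R]_3)
      ('d y x (- e) + 1 *: y x).
    by rewrite linearN scale1r -wE addNr; exact: is_derive_cst.
  have [_ D1] := is_derive_norm_local_param T_norm Wy Ux erefl dc.
  have [_ D0] : is_derive (0 : R) 1 (T \o cst (y x) : R -> R) 0.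
    exact: (is_derive_cst (T (y x))).
  by have /eqP := oner_neq0 R; rewrite -D1 D0.
split=> // c v c0 dc.
have [e eE] : exists e, v - (dot n v / dot n (y x)) *: y x = 'd y x e.
  by apply: tangent; rewrite dotBr dotZr divfK // subrr.
apply: (is_derive_norm_local_param T_norm Wy Ux c0 (e := e)).
by rewrite -eE subrK.
Qed.

(** A chart-free form of the outward normal condition, equivalent to it by [outward_unit_normalP].
    Symmetry and uniqueness are proved in this form. *)
Definition support_point n w := [/\ T w = 1, dot n n = 1 &
  forall v, T v <= 1 -> dot n v <= dot n w].

Lemma is_derive_affine w v : is_derive (0 : R) 1 (fun s : R => w + s *: v) v.
Proof.
have := is_derive_scale (is_derive_id (0 : R) (1 : R)) (is_derive_cst v (0 : R) 1).
rewrite /= scaler0 addr0 scale1r => d.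
have := is_deriveD (is_derive_cst w (0 : R) 1) d; rewrite add0r.
by [].
Qed.

(** The point n / T(n) has norm 1 and height 1 / T(n) > 0 in the direction [n]. *)
Lemma support_point_dot_gt0 n w : support_point n w -> 0 < dot n w.
Proof.
move=> [Tw nn nmax].
have n0 : n != 0 by rewrite -dot_eq0 nn oner_eq0.
have Tn : 0 < T n.
  rewrite lt_def (is_norm_ge0 T_norm) andbT.
  by apply: contra_neq n0 => /(is_norm_eq0 T_norm).
have := nmax ((T n)^-1 *: n); rewrite (is_normZ T_norm) dotZr nn mulr1.
rewrite gtr0_norm ?invr_gt0 // mulVf ?gt_eqF // lexx => /(_ isT).
by apply: lt_le_trans; rewrite invr_gt0.
Qed.

Hypothesis W_smooth : smooth_surface (wulff_shape T).

Lemma outward_unit_normalP n w : wulff_shape T w ->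
  outward_unit_normal T w n <-> support_point n w.
Proof.
move=> Ww; split=> [[nn ntan nout]|sp].
  have [U [y [Wy [x Ux yx]]]] := W_smooth Ww.
  have n0 : n != 0 by rewrite -dot_eq0 nn oner_eq0.
  have ndy e : dot n ('d y x e) = 0.
    by apply: ntan; exists U, y, x; split=> //; exists e.
  have [nw dT] := is_derive_norm_normal Wy Ux n0 ndy; rewrite yx in nw dT.
  have nw0 : 0 < dot n w.
    (* Moving along the outward direction [n] does not decrease [T], and the derivative of [T] in
       this direction is the displayed quotient. *)
    have : 0 <= dot n n / dot n w.
      apply: (@derive_ge0_at_right _ (T \o (fun s : R => w + s *: n))).
        by apply: filterS nout => s /ltW; rewrite /= scale0r addr0 Ww.
      by apply: dT; [rewrite scale0r addr0|exact: is_derive_affine].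
    by rewrite nn mul1r invr_ge0 lt_def nw.
  split=> // v Tv.
  (* By convexity the segment from [w] to [v] stays in {T <= 1}, so [T] does not increase along
     it. *)
  have : dot n (v - w) / dot n w <= 0.
    apply: (@derive_le0_at_right _ (T \o (fun s : R => w + s *: (v - w)))).
      near=> s; rewrite /= scale0r addr0 Ww.
      have -> : w + s *: (v - w) = (1 - s) *: w + s *: v.
        by rewrite scalerBr scalerBl scale1r addrCA [RHS]addrC addrA.
      apply: (le_trans (is_normD T_norm _ _)); rewrite !(is_normZ T_norm) Ww.
      have s0 : 0 < s by [].
      have s1 : s < 1 by near: s; exact: nbhs_right_lt.
      rewrite !gtr0_norm ?subr_gt0 //; nra.
    by apply: dT; [rewrite scale0r addr0|exact: is_derive_affine].
  by rewrite pmulr_lle0 ?invr_gt0 // dotBr subr_le0.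
have [Tw nn nmax] := sp; have nw0 := support_point_dot_gt0 sp.
split=> //.
  move=> v [U [y [x [Wy Ux yx [e ->]]]]].
  (* The height [<n, .>] restricted to W is maximal at [w]; using this bound for a direction and its
     opposite gives equality. *)
  have dle e' : dot n ('d y x e') <= 0.
    have dy := local_param_differentiable Wy Ux.
    apply: (@derive_le0_at_right _ (fun s : R => dot n (y (s *: e' + x)))).
      have [oU _ _ _] := Wy; apply: cvg_within.
      apply: filterS (near_line e' oU Ux) => s /(local_param_mem Wy) Ts.
      by rewrite scale0r add0r yx; apply: nmax; rewrite Ts.
    exact/is_derive_dot/is_derive_diff_line.
  apply/eqP; rewrite eq_le dle /= -oppr_le0 -dotNr -linearN; exact: dle.
near=> s.
have s0 : 0 < s by [].
(* The point w + s n is higher than [w] by s > 0, so it cannot lie in {T <= 1}. *)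
rewrite ltNge; apply/negP => /nmax; rewrite dotDr dotZr nn mulr1; lra.
Unshelve. all: by end_near. Qed.

Lemma support_pointN n w : support_point (- n) (- w) <-> support_point n w.
Proof.
suff H m u : support_point m u -> support_point (- m) (- u).
  by split=> [/H|/H //]; rewrite !opprK.
move=> [Tu mm mmax]; split.
- by rewrite (is_normN T_norm).
- by rewrite dotNl dotNr opprK.
move=> v Tv; rewrite !dotNl dotNr opprK -dotNr.
by apply: mmax; rewrite (is_normN T_norm).
Qed.

End OutwardNormal.

(** * Isolated critical points *)

Section IsolatedCriticalPoint.
Context {R : realType}.

(** The mean value theorem on the segment between 0 and [a], for either sign of [a]. *)
Lemma segment_increment_le (g dg : R -> R) (a K : R) :
  (forall s : R, `|s| <= `|a| -> is_derive s 1 g (dg s) /\ `|dg s| <= K) ->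
  `|g a - g 0| <= K * `|a|.
Proof.
move=> gK.
have [a0|a0] := leP 0 a.
  have I s : s \in `[0, a]%R -> `|s| <= `|a|.
    by rewrite in_itv /= => /andP[s0 sa]; rewrite !ger0_norm.
  have I' s : s \in `]0, a[%R -> `|s| <= `|a|.
    by move=> /subset_itv_oo_cc/I.
  have [||c /I/gK[_ cK] ->] := @MVT_segment _ g dg 0 a a0.
  - by move=> s /I'/gK[].
  - by apply: derivable_within_continuous => s /I/gK[[]].
  by rewrite subr0 normrM ler_wpM2r.
have I s : s \in `[a, 0]%R -> `|s| <= `|a|.
  by rewrite in_itv /= => /andP[s0 sa]; rewrite !ler0_norm // ?lerN2 // ltW.
have I' s : s \in `]a, 0[%R -> `|s| <= `|a|.
  by move=> /subset_itv_oo_cc/I.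
rewrite distrC.
have [||c /I/gK[_ cK] ->] := @MVT_segment _ g dg a 0 (ltW a0).
- by move=> s /I'/gK[].
- by apply: derivable_within_continuous => s /I/gK[[]].
by rewrite sub0r normrM normrN ler_wpM2r.
Qed.

Lemma is_derive_quadratic (k l s : R) :
  is_derive s 1 (fun s : R => (k * s ^+ 2 + l * s) / 2) (s * k + l / 2).
Proof.
have d : is_derive s 1 (id : R -> R) 1 by exact: is_derive_id.
have -> : (fun s : R => (k * s ^+ 2 + l * s) / 2) =
    (k / 2) *: (id * id) + (l / 2) *: id.
  by apply: funext => z; rewrite !fctE -[_ *: (_ * _)]/(_ * _) -[_ *: z]/(_ * _);
    field.
have -> : s * k + l / 2 = (k / 2) *: (s *: 1 + s *: 1) + (l / 2) *: 1.
  by rewrite -[s *: 1]/(s * 1) -[RHS]/(k / 2 * (s * 1 + s * 1) + l / 2 * 1); field.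
exact: (is_deriveD (is_deriveZ _ (is_deriveM d d)) (is_deriveZ _ d)).
Qed.

Lemma diff_estimate (g : R * R -> R) (x : R * R) (e : R) : 0 < e ->
  differentiable g x ->
  \forall h \near (0 : R * R), `|g (h + x) - g x
    - (h.1 * 'D_((1, 0) : R * R) g x + h.2 * 'D_((0, 1) : R * R) g x)|
    <= e * (`|h.1| + `|h.2|).
Proof.
move=> e0 dg; have /eqaddoP /(_ e e0) := diff_locally dg.
apply: filterS => h.
rewrite !fctE /= !deriveE // => hle.
have -> : h.1 * 'd g x (1, 0) + h.2 * 'd g x (0, 1) = 'd g x h.
  by rewrite [in RHS](pair_coords h) linearD !linearZ.
move: hle; rewrite opprD addrA => /le_trans; apply.
by rewrite ler_wpM2l ?(ltW e0) // prod_normE ge_max lerDl lerDr !normr_ge0.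
Qed.

(* Integrating the gradient first along the second and then along the first
   axis makes only one of the two mixed derivatives appear, so that their
   equality is not needed. *)
Lemma second_order_estimate (f f1 f2 : R * R -> R) (x : R * R) (e : R) :
  let L := 'D_((1, 0) : R * R) f1 x in
  let M := 'D_((0, 1) : R * R) f1 x in
  let N := 'D_((0, 1) : R * R) f2 x in
  (\forall z \near x, is_derive z ((1, 0) : R * R) f (f1 z)) ->
  (\forall z \near x, is_derive z ((0, 1) : R * R) f (f2 z)) ->
  differentiable f1 x -> differentiable f2 x -> f1 x = 0 -> f2 x = 0 -> 0 < e ->
  \forall h \near (0 : R * R), `|f (h + x) - f x
    - (L * h.1 ^+ 2 + 2 * M * h.1 * h.2 + N * h.2 ^+ 2) / 2|
    <= e * (h.1 ^+ 2 + h.2 ^+ 2).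
Proof.
move=> L M N df1 df2 d1 d2 f1x f2x e0.
(* With p, q the absolute values of the coordinates of h, precision e/2 on the gradient gives the
   error e/2 (p^2 + pq + q^2), which is at most e (p^2 + q^2). *)
have e20 : 0 < e / 2 by rewrite divr_gt0.
have n1 := diff_estimate e20 d1; have n2 := diff_estimate e20 d2.
move: df1 df2; rewrite !(near_shift 0 x) subr0 => df1 df2.
have : \forall h \near (0 : R * R), [/\
    is_derive (h + x) ((1, 0) : R * R) f (f1 (h + x)),
    is_derive (h + x) ((0, 1) : R * R) f (f2 (h + x)),
    `|f1 (h + x) - (h.1 * L + h.2 * M)| <= e / 2 * (`|h.1| + `|h.2|) &
    `|f2 (h + x) - (h.1 * 'D_((1, 0) : R * R) f2 x + h.2 * N)|
      <= e / 2 * (`|h.1| + `|h.2|)].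
  move: n1 n2; rewrite f1x f2x => n1 n2.
  near=> h; split; first (by near: h; exact: df1); first (by near: h; exact: df2).
    by rewrite -[f1 (h + x)]subr0; near: h.
  by rewrite -[f2 (h + x)]subr0; near: h.
move=> /nbhs_ballP[r /= r0 rP]; apply/nbhs_ballP; exists r => // -[a b] [].
rewrite -!ball_normE /= !sub0r !normrN => ar br.
have {}rP s t : `|s| < r -> `|t| < r -> [/\
    is_derive ((s, t) + x) ((1, 0) : R * R) f (f1 ((s, t) + x)),
    is_derive ((s, t) + x) ((0, 1) : R * R) f (f2 ((s, t) + x)),
    `|f1 ((s, t) + x) - (s * L + t * M)| <= e / 2 * (`|s| + `|t|) &
    `|f2 ((s, t) + x) - (s * 'D_((1, 0) : R * R) f2 x + t * N)|
      <= e / 2 * (`|s| + `|t|)].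
  by move=> sr tr; apply: rP; split; rewrite -ball_normE /= sub0r normrN.
(* On the path from x through x + (0, b) to x + (a, b), [g2] and [g1] are [f] minus the quadratic
   form, up to constants. Their derivatives are the errors in the linear approximations of [f2] and
   [f1]. *)
pose g1 (s : R) : R := f ((s, b) + x) - (L * s ^+ 2 + 2 * M * b * s) / 2.
pose g2 (s : R) : R := f ((0, s) + x) - (N * s ^+ 2) / 2.
have G1 : `|g1 a - g1 0| <= e / 2 * (`|a| + `|b|) * `|a|.
  apply: (@segment_increment_le _ (fun s => f1 ((s, b) + x) - (s * L + b * M))).
  move=> s sa; have [ds _ le1 _] := rP s b (le_lt_trans sa ar) br; split; last first.
    by apply: (le_trans le1); rewrite ler_wpM2l ?(ltW e20) // lerD2r.
  have -> : b * M = 2 * M * b / 2 by field.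
  have -> : g1 = (fun z => f ((z, b) + x)) -
    (fun z => (L * z ^+ 2 + 2 * M * b * z) / 2) by [].
  apply: is_deriveB; last exact: is_derive_quadratic.
  have E z : (z, b) + x = z *: ((1, 0) : R * R) + ((0, b) + x).
    by rewrite addrA [in LHS](pair_coords (z, b)) [in RHS](pair_coords (0, b)) /=
      scale0r add0r.
  move: ds; rewrite E => /is_derive_along_line; congr is_derive.
  by apply: funext => z; rewrite E.
have r00 : `|0 : R| < r by rewrite normr0.
have G2 : `|g2 b - g2 0| <= e / 2 * `|b| * `|b|.
  apply: (@segment_increment_le _ (fun s => f2 ((0, s) + x) - (s * N))).
  move=> s sb; have [_ ds _ le1] := rP 0 s r00 (le_lt_trans sb br); split; last first.
    by move: le1; rewrite mul0r add0r normr0 add0r => /le_trans; apply;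
      rewrite ler_wpM2l ?(ltW e20).
  have -> : s * N = s * N + 0 / 2 by rewrite mul0r addr0.
  have E z : (0, z) + x = z *: ((0, 1) : R * R) + x.
    by rewrite (pair_coords (0, z)) /= scale0r add0r.
  have -> : g2 = (fun z => f ((0, z) + x)) - (fun z => (N * z ^+ 2 + 0 * z) / 2).
    by apply: funext => z; rewrite /g2 !fctE mul0r addr0.
  apply: is_deriveB; last exact: is_derive_quadratic.
  move: ds; rewrite E => /is_derive_along_line; congr is_derive.
  by apply: funext => z; rewrite E.
have -> : f ((a, b) + x) - f x - (L * a ^+ 2 + 2 * M * a * b + N * b ^+ 2) / 2 =
    (g1 a - g1 0) + (g2 b - g2 0).
  by rewrite /g1 /g2 !add0r; field.
apply: (le_trans (ler_normD _ _)); apply: (le_trans (lerD G1 G2)).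
rewrite -(real_normK (num_real a)) -(real_normK (num_real b)).
move: `|a| `|b| => p q; rewrite -subr_ge0.
have -> : e * (p ^+ 2 + q ^+ 2) - (e / 2 * (p + q) * p + e / 2 * q * q) =
    e / 4 * ((p - q) ^+ 2 + p ^+ 2 + q ^+ 2) by field.
by apply: mulr_ge0; [exact: ltW (divr_gt0 e0 _)|rewrite !addr_ge0 ?sqr_ge0].
Unshelve. all: by end_near. Qed.

(** The Hessian form is definite, so its absolute value is at least a positive multiple of |h|^2. On
    the level of [f x] the second-order estimate bounds it by a smaller multiple, which forces h =
    0. *)
Lemma isolated_critical_point (f f1 f2 : R * R -> R) (x : R * R) :
  let L := 'D_((1, 0) : R * R) f1 x in
  let M := 'D_((0, 1) : R * R) f1 x in
  let N := 'D_((0, 1) : R * R) f2 x in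
  (\forall z \near x, is_derive z ((1, 0) : R * R) f (f1 z)) ->
  (\forall z \near x, is_derive z ((0, 1) : R * R) f (f2 z)) ->
  differentiable f1 x -> differentiable f2 x -> f1 x = 0 -> f2 x = 0 ->
  0 < L * N - M ^+ 2 ->
  \forall z \near x, f z = f x -> z = x.
Proof.
move=> L M N df1 df2 d1 d2 f1x f2x; set D := L * N - M ^+ 2 => D0.
(* If the trace vanished, the determinant would be -L^2 - M^2 <= 0. *)
have LN : L + N != 0.
  apply: contraTneq D0 => /eqP; rewrite addr_eq0 => /eqP LE.
  by rewrite -leNgt /D LE; nra.
have t0 : 0 < `|L + N| by rewrite normr_gt0.
(* The estimate bounds |Q|/2 by [e * s], so the factor 4 leaves |L + N| |Q| <= D s / 2, half of the
   lower bound [QD]. *)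
pose e := D / `|L + N| / 4.
have e0 : 0 < e by rewrite !divr_gt0.
have := second_order_estimate df1 df2 d1 d2 f1x f2x e0.
rewrite (near_shift 0 x) subr0; apply: filterS => h /= hle fh.
move: hle; rewrite fh subrr sub0r normrN -/L -/M -/N => hle.
set Q := L * _ + _ + _ in hle; set s := _ + _ in hle.
have s0 : 0 <= s by rewrite addr_ge0 ?sqr_ge0.
(* Cayley-Hamilton for the symmetric matrix H with entries L, M, N: tr(H) <h, Hh> = |Hh|^2 + det(H)
   |h|^2. *)
have QD : D * s <= `|L + N| * `|Q|.
  rewrite -normrM; apply: (le_trans _ (ler_norm _)).
  have -> : (L + N) * Q = (L * h.1 + M * h.2) ^+ 2 + (M * h.1 + N * h.2) ^+ 2 + D * s.
    by rewrite /Q /s /D; ring.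
  by rewrite lerDr addr_ge0 ?sqr_ge0.
have Qe : `|L + N| * `|Q| <= D * s / 2.
  move: hle; rewrite normrM [X in _ * X]ger0_norm ?invr_ge0 // => hle.
  have := ler_wpM2l (ltW t0) hle; rewrite /e => {}hle.
  have E : `|L + N| * (D / `|L + N| / 4 * s) = D * s / 4.
    by field; rewrite gt_eqF.
  by rewrite E in hle; lra.
have {}s0 : s = 0.
  apply/eqP; rewrite eq_le s0 andbT -(pmulr_rle0 _ D0); lra.
have -> : h = 0.
  move: s0 => /eqP; rewrite /s paddr_eq0 ?sqr_ge0 // !sqrf_eq0 => /andP[].
  by case: h {fh hle Q s Qe QD} => a b /= /eqP -> /eqP ->.
by rewrite add0r.
Qed.

End IsolatedCriticalPoint.

(** * Uniqueness of the support point in a given direction *)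

Section SupportPoints.
Context {R : realType} (T : 'rV[R]_3 -> R) (T_norm : is_norm T).
Hypothesis W_smooth : smooth_surface (wulff_shape T).
Hypothesis W_curved : positive_curvature (wulff_shape T).
Implicit Types (u v w n : 'rV[R]_3) (U : set (R * R)) (y : R * R -> 'rV[R]_3).

Lemma patch_normal_perp y x n :
  cross (du y x) (dv y x) != 0 -> n != 0 ->
  dot n (du y x) = 0 -> dot n (dv y x) = 0 -> exists r, patch_normal y x = r *: n.
Proof.
rewrite /patch_normal; move: (du y x) (dv y x) => a b /= c0 n0 na nb.
have := perp_parallel_cross c0 na nb; move: (_ / _) => k nE.
have k0 : k != 0 by apply: contraNneq n0 => k0; rewrite nE k0 scale0r.
exists ((Num.sqrt (dot (cross a b) (cross a b)))^-1 / k).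
by rewrite [in RHS]nE scalerA divfK.
Qed.

(** The numerator LN - M^2 is homogeneous of degree two in the normal, so its sign is the same for
    every nonzero normal, of either orientation. *)
Lemma gauss_curvature_gt0_perp y x n :
  cross (du y x) (dv y x) != 0 -> n != 0 ->
  dot n (du y x) = 0 -> dot n (dv y x) = 0 -> 0 < gauss_curvature y x ->
  0 < dot (du (du y) x) n * dot (dv (dv y) x) n - dot (dv (du y) x) n ^+ 2.
Proof.
have scale_pos (a b c m : 'rV[R]_3) (r g : R) : m = r *: n -> 0 <= g ->
    0 < (dot a m * dot b m - dot c m ^+ 2) / g ->
    0 < dot a n * dot b n - dot c n ^+ 2.
  move=> -> g0; rewrite !dotZr => H.
  have gi : 0 <= r ^+ 2 * g^-1 by rewrite mulr_ge0 ?sqr_ge0 ?invr_ge0.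
  rewrite ltNge; apply/negP => D0; move: H; rewrite ltNge => /negP; apply.
  rewrite (_ : _ / g = r ^+ 2 * g^-1 * (dot a n * dot b n - dot c n ^+ 2)).
    exact: mulr_ge0_le0.
  by ring.
move=> c0 n0 nu nv; have [r rE] := patch_normal_perp c0 n0 nu nv.
by apply: (scale_pos _ _ _ _ r (gram y x) rE); rewrite /gram -lagrange_identity dot_ge0.
Qed.

Lemma support_point_critical U y x n : local_param (wulff_shape T) U y -> U x ->
  support_point T n (y x) -> dot n (du y x) = 0 /\ dot n (dv y x) = 0.
Proof.
move=> Wy Ux sp; have Ww := local_param_mem Wy Ux.
have [_ tan _] := (outward_unit_normalP T_norm W_smooth n Ww).2 sp.
have dy := local_param_differentiable Wy Ux.
by split; apply: tan; exists U, y, x; split=> //;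
  [exists (1, 0)|exists (0, 1)]; rewrite -deriveE.
Qed.

(** In a parametrization around [w1], the height [<n, .>] has a critical point whose Hessian is the
    second fundamental form with respect to [n]. Its determinant is positive, so
    [isolated_critical_point] applies. *)
Lemma support_point_unique n w1 w2 :
  support_point T n w1 -> support_point T n w2 -> w1 = w2.
Proof.
move=> sp1 sp2; have [Tw1 nn max1] := sp1; have [Tw2 _ max2] := sp2.
have h1 := support_point_dot_gt0 T_norm sp1.
have h12 : dot n w1 = dot n w2.
  by apply/eqP; rewrite eq_le max1 ?Tw2 // max2 ?Tw1.
apply/eqP/negPn/negP => w12.
have [U [y [Wy [x Ux yx]]]] := W_smooth Tw1.
have [oU Uy _ yopen] := Wy.
have n0 : n != 0 by rewrite -dot_eq0 nn oner_eq0.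
have cross0 := immersed_patch_cross Uy Ux.
have [nu nv] : dot n (du y x) = 0 /\ dot n (dv y x) = 0.
  by apply: support_point_critical Wy Ux _; rewrite yx.
have [dy ddu ddv] := immersed_patch_differentiable Uy Ux.
have UN : \forall z \near x, U z by exact: open_nbhs_nbhs.
have iso : \forall z \near x, dot n (y z) = dot n (y x) -> z = x.
  apply: (@isolated_critical_point _ (fun z => dot n (y z))
    (fun z => dot n (du y z)) (fun z => dot n (dv y z))) => //.
  - apply: filterS UN => z Uz; apply: is_derive_dot; rewrite /du deriveE.
      exact/is_derive_diff/(local_param_differentiable Wy).
    exact: (local_param_differentiable Wy).
  - apply: filterS UN => z Uz; apply: is_derive_dot; rewrite /dv deriveE.
      exact/is_derive_diff/(local_param_differentiable Wy).
    exact: (local_param_differentiable Wy).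
  - exact: (@differentiable_dot _ _ (cst n) (du y) x (differentiable_cst n x) ddu).
  - exact: (@differentiable_dot _ _ (cst n) (dv y) x (differentiable_cst n x) ddv).
  have dE (v : R * R) (g : R * R -> 'rV[R]_3) : differentiable g x ->
      'D_v (fun z => dot n (g z)) x = dot ('D_v g x) n.
    move=> dg; rewrite dotC.
    by have [] := is_derive_dot n (derivableP (@diff_derivable _ _ _ g x v dg)).
  have := gauss_curvature_gt0_perp cross0 n0 nu nv (W_curved Wy Ux).
  congr (0 < _ * _ - _ ^+ 2); apply: esym.
  - exact: (dE (1, 0) (du y) ddu).
  - exact: (dE (0, 1) (dv y) ddv).
  - exact: (dE (0, 1) (du y) ddu).
have /nbhs_ballP[r /= r0 rP] := iso.
(* Since [y] is open onto its image in W, isolation of the parameter [x] becomes isolation of the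
   point [w1] within W. *)
have [V oV UV] : exists2 V, open V & y @` (U `&` ball x r) = wulff_shape T `&` V.
  by apply: yopen; [apply: openI => //; exact: ball_open|exact: subIsetl].
have Vw1 : V w1.
  have : (y @` (U `&` ball x r)) w1 by exists x => //; split=> //; exact: ballxx.
  by rewrite UV => -[].
have Vs : \forall s \near (0 : R)^'+, V (s *: (w2 - w1) + w1).
  by apply: cvg_within; exact: near_line.
suff /filter_ex[] : \forall s \near (0 : R)^'+, False by [].
near=> s.
have s0 : 0 < s by [].
have s1 : s < 1 by near: s; exact: nbhs_right_lt.
have : V (s *: (w2 - w1) + w1) by near: s; exact: Vs.
set m := s *: (w2 - w1) + w1 => Vm.
have nm : dot n m = dot n w1.
  by rewrite /m dotDr dotZr dotBr h12 subrr mulr0 add0r.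
have Tm1 : T m <= 1.
  have -> : m = s *: w2 + (1 - s) *: w1.
    by rewrite /m scalerBr scalerBl scale1r -addrA [- _ + _]addrC.
  apply: (le_trans (is_normD T_norm _ _)).
  by rewrite !(is_normZ T_norm) Tw1 Tw2 !gtr0_norm ?subr_gt0 // !mulr1 addrC subrK.
have Tm0 : 0 < T m.
  rewrite lt_def (is_norm_ge0 T_norm) andbT.
  apply: contraTneq h1 => /(is_norm_eq0 T_norm) m0.
  by rewrite -nm m0 dot0r ltxx.
(* If T(m) < 1, the rescaled point m / T(m) would lie in the ball and exceed the maximal height. *)
have Tm : T m = 1.
  apply/eqP; rewrite eq_le Tm1 /=.
  have := max1 ((T m)^-1 *: m); rewrite (is_normZ T_norm) dotZr nm.
  rewrite gtr0_norm ?invr_gt0 // mulVf ?gt_eqF // lexx => /(_ isT).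
  by rewrite ler_pdivrMl // -ler_pdivrMr // divff // gt_eqF.
have [z [Uz xz] yz] : (y @` (U `&` ball x r)) m by rewrite UV.
have zx : z = x by apply: (rP _ xz); rewrite yz yx.
(* Now [m] equals [w1], that is s (w2 - w1) = 0 with s > 0, against w1 != w2. *)
move: yz; rewrite zx yx /m => /eqP; rewrite -subr_eq subrr eq_sym scaler_eq0.
by rewrite gt_eqF //= subr_eq0 eq_sym (negbTE w12).
Unshelve. all: by end_near. Qed.

(* Both sides are the junk value 0 when no point of the Wulff shape has n as
   outward unit normal. *)
Lemma xget_outward_unit_normalN n :
  xget 0 [set w | wulff_shape T w /\ outward_unit_normal T w (- n)] =
  - xget 0 [set w | wulff_shape T w /\ outward_unit_normal T w n].
Proof.
have supp m w : wulff_shape T w /\ outward_unit_normal T w m -> support_point T m w.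
  by move=> [Ww /(outward_unit_normalP T_norm W_smooth _ Ww)].
have norm m w : support_point T m w -> wulff_shape T w /\ outward_unit_normal T w m.
  move=> sp; have Ww : wulff_shape T w by case: sp.
  by split=> //; apply/(outward_unit_normalP T_norm W_smooth _ Ww).
case: (xgetP 0 [set w | wulff_shape T w /\ outward_unit_normal T w n])
  => [w _ /supp sp|none].
  apply: xget_unique => [|u /supp spu]; first exact/norm/support_pointN.
  by apply: support_point_unique spu _; exact/support_pointN.
rewrite oppr0; apply: xgetPN => w /supp spw; apply: (none (- w)).
by apply: norm; rewrite -[n]opprK; exact: (support_pointN T_norm _ _).2.
Qed.

End SupportPoints.

(** * Unit normals in charts *)

Section NormalizedCross.
Context {R : realType}.
Implicit Types (a b c n : 'rV[R]_3).

(** Chosen so that [patch_normal] is convertible to [normalize] of the cross product of the partial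
    derivatives. *)
Definition normalize c : 'rV[R]_3 := (Num.sqrt (dot c c))^-1 *: c.

Lemma dot_gt0 c : c != 0 -> 0 < dot c c.
Proof. by move=> c0; rewrite lt_def dot_eq0 c0 dot_ge0. Qed.

Lemma dot_normalize c : c != 0 -> dot (normalize c) (normalize c) = 1.
Proof.
move=> /dot_gt0 c0; rewrite /normalize dotZl dotZr mulrA -expr2 exprVn.
by rewrite sqr_sqrtr ?ltW // mulVf // gt_eqF.
Qed.

Lemma dot_normalizer_gt0 c : c != 0 -> 0 < dot c (normalize c).
Proof.
by move=> /dot_gt0 c0; rewrite /normalize dotZr mulr_gt0 // invr_gt0 sqrtr_gt0.
Qed.

Lemma normalizeZ (k : R) c : k != 0 -> normalize (k *: c) = Num.sg k *: normalize c.
Proof.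
move=> k0; rewrite /normalize dotZl dotZr mulrA -expr2 sqrtrM ?sqr_ge0 //.
rewrite sqrtr_sqr invfM !scalerA; congr (_ *: c).
have kE : `|k|^-1 * k = Num.sg k.
  by rewrite {2}[k]numEsg mulrC mulfK // normr_eq0.
by rewrite mulrAC kE.
Qed.

(** A vector orthogonal to [a] and [b] is a multiple of their cross product, and normalizing retains
    only the sign of the factor. *)
Lemma perp_normalize a b n : cross a b != 0 ->
  dot n a = 0 -> dot n b = 0 -> n != 0 ->
  normalize n = Num.sg (dot n (cross a b)) *: normalize (cross a b) /\
  dot n (cross a b) != 0.
Proof.
move=> c0 na nb n0; have nE := perp_parallel_cross c0 na nb.
have d0 : dot n (cross a b) != 0.
  by apply: contraNneq n0 => d0; rewrite nE d0 mul0r scale0r.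
split=> //; rewrite {1}nE normalizeZ; last first.
  by rewrite mulf_neq0 // invr_eq0 gt_eqF // dot_gt0.
by rewrite sgrM sgrV (gtr0_sg (dot_gt0 c0)) mulr1.
Qed.

Lemma normalize_unit n : dot n n = 1 -> normalize n = n.
Proof. by move=> nn; rewrite /normalize nn sqrtr1 invr1 scale1r. Qed.

End NormalizedCross.

Section Charts.
Context {R : realType} (S : oriented_surface R).
Implicit Types (F : S -> 'rV[R]_3) (x e : R * R).

Section ChartChange.
Variables (j k : nat) (x : R * R).
Hypotheses (kx : dom S k x) (jx : (param S j @` dom S j) (param S k x)).
Let tau := @Defs.coord R S j \o param S k.

Lemma transition_differentiable : differentiable tau x.
Proof. exact: (transition_smooth S j k 1).1. Qed.

(** Multiplicativity of determinants; the first factor is the Jacobian of the transition map,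
    positive by [transition_oriented]. *)
Lemma det2_transition e1 e2 :
  det2 ('d tau x e1) ('d tau x e2) =
  det2 ('D_((1, 0) : R * R) tau x) ('D_((0, 1) : R * R) tau x) * det2 e1 e2.
Proof.
have dt := transition_differentiable.
have E e : 'd tau x e =
    e.1 *: 'd tau x ((1, 0) : R * R) + e.2 *: 'd tau x ((0, 1) : R * R).
  by rewrite [in LHS](pair_coords e) linearD !linearZ.
rewrite !deriveE // (E e1) (E e2).
move: ('d tau x _) ('d tau x _) => [a b] [c d]; rewrite /det2 /=.
by rewrite -![_ *: _]/(_ * _); ring.
Qed.

Lemma det2_transition_gt0 e1 e2 :
  0 < det2 e1 e2 -> 0 < det2 ('d tau x e1) ('d tau x e2).
Proof. by move=> e0; rewrite det2_transition mulr_gt0 // transition_oriented. Qed.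

Lemma det2_transition_neq0 e1 e2 :
  det2 e1 e2 != 0 -> det2 ('d tau x e1) ('d tau x e2) != 0.
Proof.
by move=> e0; rewrite det2_transition mulf_neq0 // gt_eqF // transition_oriented.
Qed.

Lemma transition_near :
  \forall z \near x, dom S k z /\ (param S j @` dom S j) (param S k z).
Proof.
near=> z; split; near: z.
  by apply: open_nbhs_nbhs; split=> //; exact: dom_open.
apply: (param_continuous kx); apply: open_nbhs_nbhs; split=> //.
exact: image_open.
Unshelve. all: by end_near. Qed.

Lemma diff_chart_change F e :
  differentiable (F \o param S k) x -> differentiable (F \o param S j) (tau x) ->
  'd (F \o param S k) x e = 'd (F \o param S j) (tau x) ('d tau x e).
Proof.
move=> dk dj; apply: diff_near_comp => //; first exact: transition_differentiable.
apply: filterS transition_near => z [_ [u ju uz]].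
by rewrite /= /tau /= -uz paramK.
Qed.

End ChartChange.

(** Orthogonality determines a unit vector up to sign, and the orientation condition on the
    coordinate basis selects the sign. *)
Lemma unit_normal_unique F k x : immersion F -> dom S k x -> forall n,
  is_unit_normal F (param S k x) n -> n = patch_normal (F \o param S k) x.
Proof.
move=> Fimm kx n [nn /(_ k x kx erefl)] /= [perp pos].
have [dF _ _] := immersed_patch_differentiable (Fimm k) kx.
have c0 := immersed_patch_cross (Fimm k) kx.
rewrite -[RHS]/(normalize (cross (du (F \o param S k) x) (dv (F \o param S k) x))).
have := pos (1, 0) (0, 1); have := perp (1, 0); have := perp (0, 1).
rewrite -!deriveE // -/(du _) -/(dv _) => nv nu.
rewrite /det2 /= mulr1 mulr0 subr0 ltr01 => /(_ isT).
rewrite /det3 dotC => cn.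
have n0 : n != 0 by rewrite -dot_eq0 nn oner_eq0.
have [+ _] := perp_normalize c0 nu nv n0.
by rewrite (gtr0_sg cn) scale1r normalize_unit.
Qed.

(** The conditions range over all charts at the point. A chart change composes the differential with
    a map of positive determinant, which preserves both the tangent plane and its orientation. *)
Lemma is_unit_normal_patch F k x : immersion F -> dom S k x ->
  is_unit_normal F (param S k x) (patch_normal (F \o param S k) x).
Proof.
move=> Fimm kx.
have [dF _ _] := immersed_patch_differentiable (Fimm k) kx.
have c0 := immersed_patch_cross (Fimm k) kx.
rewrite -[patch_normal _ _]/(normalize
  (cross (du (F \o param S k) x) (dv (F \o param S k) x))).
have FE e := diff_coords e dF.
move: (du _ _) (dv _ _) c0 FE => a b c0 FE.
split=> [|j z jz zx]; first exact: dot_normalize.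
have kz : (param S k @` dom S k) (param S j z) by exists x.
have tz : (@Defs.coord R S k \o param S j) z = x by rewrite /= zx paramK.
have [dFj _ _] := immersed_patch_differentiable (Fimm j) jz.
have dFE e := @diff_chart_change k j z jz kz F e dFj.
have key (u : R * R -> R * R) (D : R * R -> 'rV[R]_3) :
    (forall e1 e2, 0 < det2 e1 e2 -> 0 < det2 (u e1) (u e2)) ->
    (forall e, D e = (u e).1 *: a + (u e).2 *: b) ->
    (forall e, dot (normalize (cross a b)) (D e) = 0) /\
    (forall e1 e2, 0 < det2 e1 e2 -> 0 < det3 (D e1) (D e2) (normalize (cross a b))).
  move=> upos DE; split=> [e|e1 e2 e12].
    rewrite DE /normalize dotZl dotDr !dotZr dot_crossl dot_crossr.
    by rewrite !mulr0 addr0 mulr0.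
  by rewrite !DE /det3 cross_comb dotZl mulr_gt0 ?dot_normalizer_gt0 ?upos.
rewrite tz in dFE; apply: (key _ _ (det2_transition_gt0 jz kz)) => e.
apply: etrans (dFE e dF) _.
exact: (FE ('d (@Defs.coord R S k \o param S j) z e)).
Qed.

Lemma unit_normal_patch F k x : immersion F -> dom S k x ->
  unit_normal F (param S k x) = patch_normal (F \o param S k) x.
Proof.
move=> Fimm kx; apply: xget_unique => [|n]; first exact: is_unit_normal_patch.
exact: unit_normal_unique.
Qed.

End Charts.

(** * Generalized eigenvalues *)

Section PrincipalCurvatures.
Context {R : realType}.
Implicit Types (a b p q : 'rV[R]_3) (l m e : R * R).

(* The linear maps e |-> e.1 a + e.2 b and e |-> e.1 p + e.2 q play the roles of
   dX and dxi. *)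
Definition generalized_eigenvalues a b p q l := exists e1 e2 : R * R,
  [/\ det2 e1 e2 != 0,
      e1.1 *: p + e1.2 *: q = - l.1 *: (e1.1 *: a + e1.2 *: b) &
      e2.1 *: p + e2.2 *: q = - l.2 *: (e2.1 *: a + e2.2 *: b)].

(** The determinant identity: both sides are compared after evaluating the two maps on the
    eigenbasis and taking cross products. *)
Lemma eigenvalues_prod a b p q l : generalized_eigenvalues a b p q l ->
  cross p q = (l.1 * l.2) *: cross a b.
Proof.
move=> [e1 [e2 [e0 E1 E2]]]; apply: (scalerI e0).
by rewrite -cross_comb E1 E2 crossZZ cross_comb mulrNN !scalerA mulrC.
Qed.

(** The trace identity, by the polarized form of the argument for the determinant. *)
Lemma eigenvalues_sum a b p q l : generalized_eigenvalues a b p q l ->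
  cross a q + cross p b = - (l.1 + l.2) *: cross a b.
Proof.
move=> [e1 [e2 [e0 E1 E2]]]; apply: (scalerI e0).
rewrite -cross_comb2 E1 E2.
rewrite crossZr crossZl -scalerDl cross_comb !scalerA.
by congr (_ *: _); ring.
Qed.

(** The expression equals ((u + v)^2 - 4uv) / (uv)^2 with u, v the eigenvalues, so it depends only
    on their sum and product. Hence the pair picked by [xget], in whichever order, does not
    matter. *)
Lemma eigenvalues_inv_diff a b p q l m :
  cross a b != 0 -> cross p q != 0 ->
  generalized_eigenvalues a b p q l -> generalized_eigenvalues a b p q m ->
  ((l.1)^-1 - (l.2)^-1) ^+ 2 = ((m.1)^-1 - (m.2)^-1) ^+ 2.
Proof.
move=> ab0 pq0 Pl Pm.
have prod : l.1 * l.2 = m.1 * m.2.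
  apply/eqP; have := eigenvalues_prod Pl; rewrite (eigenvalues_prod Pm) => /eqP.
  by rewrite -subr_eq0 -scalerBl scaler_eq0 (negbTE ab0) orbF subr_eq0 eq_sym.
have sum : l.1 + l.2 = m.1 + m.2.
  apply/eqP; have := eigenvalues_sum Pl; rewrite (eigenvalues_sum Pm) => /eqP.
  rewrite -subr_eq0 -scalerBl scaler_eq0 (negbTE ab0) orbF.
  by rewrite opprK addrC subr_eq0.
have : l.1 * l.2 != 0.
  by apply: contraNneq pq0 => l0; rewrite (eigenvalues_prod Pl) l0 scale0r.
have inv_diff (u v : R) : u * v != 0 ->
    (u^-1 - v^-1) ^+ 2 = ((u + v) ^+ 2 - 4 * (u * v)) / (u * v) ^+ 2.
  by rewrite mulf_eq0 negb_or => /andP[u0 v0]; field; rewrite u0 v0.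
by move=> l0; rewrite inv_diff // inv_diff -?prod // sum.
Qed.

(** The eigenvectors are kept: the parallel differential multiplies the image of the i-th one by 1 -
    t l_i. A vanishing factor would make the parallel frame degenerate, and a vanishing l_i would
    make [cross p q] zero. *)
Lemma eigenvalues_parallel (s t : R) a b p q l :
  cross p q != 0 -> cross (a + t *: p) (b + t *: q) != 0 ->
  generalized_eigenvalues a b p q l ->
  [/\ l.1 != 0, l.2 != 0, 1 - t * l.1 != 0, 1 - t * l.2 != 0 &
  generalized_eigenvalues (a + t *: p) (b + t *: q) (s *: p) (s *: q)
    (s * l.1 / (1 - t * l.1), s * l.2 / (1 - t * l.2))].
Proof.
move=> pq0 abt0 Pl.
have : l.1 * l.2 != 0.
  by apply: contraNneq pq0 => l0; rewrite (eigenvalues_prod Pl) l0 scale0r.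
rewrite mulf_eq0 negb_or => /andP[l10 l20].
have [e1 [e2 [e0 E1 E2]]] := Pl.
have At (e : R * R) (k : R) : e.1 *: p + e.2 *: q = - k *: (e.1 *: a + e.2 *: b) ->
    e.1 *: (a + t *: p) + e.2 *: (b + t *: q) =
    (1 - t * k) *: (e.1 *: a + e.2 *: b).
  move=> E; have -> : e.1 *: (a + t *: p) + e.2 *: (b + t *: q) =
      e.1 *: a + e.2 *: b + t *: (e.1 *: p + e.2 *: q) by row_ring.
  by rewrite E scalerA -{1}[e.1 *: a + _]scale1r -scalerDl mulrN.
have : (1 - t * l.1) * (1 - t * l.2) != 0.
  apply: contraNneq abt0 => k0; apply/eqP/(scalerI e0).
  by rewrite scaler0 -cross_comb (At _ _ E1) (At _ _ E2) crossZZ k0 scale0r.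
rewrite mulf_eq0 negb_or => /andP[k10 k20]; split=> //.
have Es (e : R * R) (k : R) : 1 - t * k != 0 ->
    e.1 *: p + e.2 *: q = - k *: (e.1 *: a + e.2 *: b) ->
    e.1 *: (s *: p) + e.2 *: (s *: q) =
    - (s * k / (1 - t * k)) *: (e.1 *: (a + t *: p) + e.2 *: (b + t *: q)).
  move=> k0 E; rewrite (At _ _ E).
  have -> : e.1 *: (s *: p) + e.2 *: (s *: q) = s *: (e.1 *: p + e.2 *: q).
    by row_ring.
  by rewrite E !scalerA; congr (_ *: _); field.
by exists e1, e2; split=> //=; apply: Es.
Qed.

(** Each reciprocal becomes s (1/l_i - t), so the difference is multiplied by [s], which the square
    removes. *)
Lemma laguerre_density_parallel (s t : R) a b p q :
  s ^+ 2 = 1 -> cross a b != 0 -> cross p q != 0 ->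
  cross (a + t *: p) (b + t *: q) != 0 ->
  let l := xget (0, 0) [set l | generalized_eigenvalues a b p q l] in
  let m := xget (0, 0) [set m | generalized_eigenvalues
    (a + t *: p) (b + t *: q) (s *: p) (s *: q) m] in
  ((m.1)^-1 - (m.2)^-1) ^+ 2 = ((l.1)^-1 - (l.2)^-1) ^+ 2.
Proof.
move=> s1 ab0 pq0 abt0 l m.
have s0 : s != 0 by apply: contraTneq (oner_neq0 R) => s0; rewrite -s1 s0 expr0n eqxx.
have sV : s^-1 = s by rewrite -[RHS]mul1r -(mulVf s0) -mulrA -expr2 s1 mulr1.
have spq0 : cross (s *: p) (s *: q) != 0.
  by rewrite crossZZ -expr2 s1 scale1r.
rewrite /l /m {l m}; case: xgetP => [m _ Pm|none].
  (* Passing to the parallel surface is undone by the parameter -(t s) and the sign [s], so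
     eigenvalues of the parallel data yield eigenvalues of the original data. *)
  have Pl : exists l, generalized_eigenvalues a b p q l.
    have aE (u v : 'rV[R]_3) : u + t *: v + (- (t * s)) *: (s *: v) = u.
      rewrite scalerA mulNr -mulrA -expr2 s1 mulr1 scaleNr addrK //.
    have sE (v : 'rV[R]_3) : s *: (s *: v) = v by rewrite scalerA -expr2 s1 scale1r.
    have := @eigenvalues_parallel s (- (t * s)) _ _ _ _ _ spq0 _ Pm.
    by rewrite !aE !sE => /(_ ab0)[_ _ _ _ Pl]; eexists; exact: Pl.
  case: xgetP => [l _ {}Pl|none]; last by case: Pl => l /none.
  have [l1 l2 k1 k2 Pm'] := eigenvalues_parallel s pq0 abt0 Pl.
  rewrite (eigenvalues_inv_diff abt0 spq0 Pm Pm') /=.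
  have invE (u : R) : u != 0 -> 1 - t * u != 0 ->
      (s * u / (1 - t * u))^-1 = s * (u^-1 - t).
    by move=> u0 k0; rewrite -{2}sV; field; rewrite u0 k0 s0.
  by rewrite !invE // -mulrBr exprMn s1 mul1r; congr (_ ^+ 2); ring.
(* Without eigenvalues of the parallel data there are none originally either, and both choices are
   the default [(0, 0)]. *)
case: xgetP => [l _ Pl|//].
by have [_ _ _ _ /none] := eigenvalues_parallel s pq0 abt0 Pl.
Qed.

End PrincipalCurvatures.

(** * Parallel surfaces *)

Section ParallelSurface.
Context {R : realType}.
Implicit Types (y : R * R -> 'rV[R]_3) (x : R * R).

(* With T o eta locally constant, its derivative, which is proportional to the
   normal component of d eta, vanishes. *)
Lemma diff_wulff_perp (V : normedModType R) (T : 'rV[R]_3 -> R)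
    (eta : V -> 'rV[R]_3) (x v : V) (n : 'rV[R]_3) :
  is_norm T -> smooth_surface (wulff_shape T) ->
  differentiable eta x -> (forall z, eta z = 0 \/ wulff_shape T (eta z)) ->
  (eta x <> 0 -> outward_unit_normal T (eta x) n) ->
  dot n ('d eta x v) = 0.
Proof.
move=> T_norm W_smooth deta eta01 etan.
pose c (s : R) := eta (s *: v + x).
have c0 : c 0 = eta x by rewrite /c scale0r add0r.
have dc : is_derive (0 : R) 1 c ('d eta x v) := is_derive_diff_line v deta.
have cc : {for (0 : R), continuous c}.
  by apply/differentiable_continuous/derivable1_diffP; case: dc.
have cTc : {for (0 : R), continuous (T \o c)}.
  by apply: continuous_comp => //; exact: is_norm_continuous.
have zero_or_one s : c s = 0 \/ T (c s) = 1 by exact: eta01.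
(* The threshold 1/2 separates the only values 0 and 1 of [T \o c], so continuity makes this
   function constant near 0. *)
have half : 0 < (2^-1 : R) < 1 by rewrite invr_gt0 ltr0n invf_lt1 ?ltr1n ?ltr0n.
have /andP[half0 half1] := half.
(* At the default value 0 of the field, [c] itself vanishes near 0 and so does its derivative. *)
have [ex0|Wx] := eta01 x.
  have Tc0 : (T \o c) 0 < 2^-1 by rewrite /= c0 ex0 (is_norm0 T_norm).
  have near0 : \forall s \near (0 : R), cst 0 s = c s.
    apply: filterS (cvgr_lt _ cTc _ Tc0) => s /= Tcs.
    by have [->//|Tc1] := zero_or_one s; move: Tcs; rewrite Tc1 ltNge ltW.
  have dc0 : is_derive (0 : R) 1 c 0.
    by apply: near_eq_is_derive near0 _; exact: is_derive_cst.
  have [_ E1] := dc; have [_ E2] := dc0.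
  by rewrite -E1 E2 dot0r.
have ex0 : eta x <> 0.
  by move=> e0; move: Wx; rewrite /wulff_shape /= e0 (is_norm0 T_norm) => /eqP;
    rewrite eq_sym oner_eq0.
have [nn tan _] := etan ex0.
have [U [y [Wy [z Uz yz]]]] := W_smooth _ Wx.
have n0 : n != 0 by rewrite -dot_eq0 nn oner_eq0.
have ndy e : dot n ('d y z e) = 0.
  by apply: tan; exists U, y, z; split=> //; exists e.
have [nw dT] := is_derive_norm_normal T_norm Wy Uz n0 ndy.
rewrite yz -c0 in nw dT.
have Tc0 : 2^-1 < (T \o c) 0 by rewrite /= c0 Wx.
have near1 : \forall s \near (0 : R), cst 1 s = (T \o c) s.
  apply: filterS (cvgr_gt _ cTc _ Tc0) => s /= Tcs.
  have [cs0|->//] := zero_or_one s; move: Tcs.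
  by rewrite cs0 (is_norm0 T_norm) ltNge ltW.
have [_ E1] : is_derive (0 : R) 1 (T \o c) 0.
  by apply: near_eq_is_derive near1 _; exact: is_derive_cst.
have [_ E2] := dT c _ erefl dc.
move: E2; rewrite E1 => /esym/eqP; rewrite mulf_eq0 invr_eq0 (negbTE nw) orbF.
by move=> /eqP.
Qed.

(** Both normals are orthogonal to the same plane. Their relative sign is that of the inner product
    of the two cross products, which is continuous and never zero. *)
Lemma patch_normal_sign (U : set (R * R)) (y y' : R * R -> 'rV[R]_3) x :
  open U -> immersed_patch U y -> immersed_patch U y' -> U x ->
  (forall z, U z -> dot (cross (du y z) (dv y z)) (du y' z) = 0 /\
                    dot (cross (du y z) (dv y z)) (dv y' z) = 0) ->
  exists2 s : R, s ^+ 2 = 1 &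
    \forall z \near x, U z /\ patch_normal y' z = s *: patch_normal y z.
Proof.
move=> oU Uy Uy' Ux perp.
(* The inner product of the cross products, expanded by the Binet-Cauchy identity so that continuity
   follows from that of the partial derivatives. *)
pose d z := dot (du y z) (du y' z) * dot (dv y z) (dv y' z)
  - dot (du y z) (dv y' z) * dot (dv y z) (du y' z).
have sgE z : U z -> d z != 0 /\
    patch_normal y z = Num.sg (d z) *: patch_normal y' z.
  move=> Uz; have [pu pv] := perp z Uz.
  have c0 := immersed_patch_cross Uy Uz; have c0' := immersed_patch_cross Uy' Uz.
  have [E d0] := perp_normalize c0' pu pv c0.
  have binet (a b a' b' : 'rV[R]_3) : dot (cross a b) (cross a' b') =
      dot a a' * dot b b' - dot a b' * dot b a' by rewrite !dotE !crossE; ring.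
  by move: E d0; rewrite binet.
have cd : {for x, continuous d}.
  have [_ ddu ddv] := immersed_patch_differentiable Uy Ux.
  have [_ ddu' ddv'] := immersed_patch_differentiable Uy' Ux.
  apply: differentiable_continuous; apply: differentiableB; apply: differentiableM.
  - exact: (differentiable_dot ddu ddu').
  - exact: (differentiable_dot ddv ddv').
  - exact: (differentiable_dot ddu ddv').
  - exact: (differentiable_dot ddv ddu').
clearbody d; have [d0 _] := sgE x Ux.
have s1 : Num.sg (d x) ^+ 2 = 1 by rewrite sqr_sg d0.
exists (Num.sg (d x)) => //.
have sgd : \forall z \near x, Num.sg (d z) = Num.sg (d x).
  move: d0; rewrite neq_lt => /orP[dx|dx].
    by apply: filterS (cvgr_lt _ cd _ dx) => z dz; rewrite !ltr0_sg.
  by apply: filterS (cvgr_gt _ cd _ dx) => z dz; rewrite !gtr0_sg.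
have UN : \forall z \near x, U z by exact: open_nbhs_nbhs.
apply: filterS2 UN sgd => z Uz sz; split=> //.
have [_ E] := sgE z Uz.
by rewrite E sz scalerA -expr2 s1 scale1r.
Qed.

Lemma area_density_scale (s : R) y y' x : s ^+ 2 = 1 ->
  du y' x = s *: du y x -> dv y' x = s *: dv y x ->
  area_density y' x = area_density y x.
Proof.
move=> s1 uE vE; rewrite /area_density /gram uE vE.
congr Num.sqrt; move: (du y x) (dv y x) => a b.
have sE (k : R) : s * (s * k) = k by rewrite mulrA -expr2 s1 mul1r.
by rewrite !dotZl !dotZr !sE.
Qed.

Lemma area_density_degenerate y x : cross (du y x) (dv y x) = 0 ->
  area_density y x = 0.
Proof.
by move=> c0; rewrite /area_density /gram -lagrange_identity c0 dot0r sqrtr0.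
Qed.

End ParallelSurface.

(** * Invariance of the Laguerre integrand *)

Section Laguerre.
Context {R : realType} (T : 'rV[R]_3 -> R) (T_norm : is_norm T).
Hypothesis W_smooth : smooth_surface (wulff_shape T).
Hypothesis W_curved : positive_curvature (wulff_shape T).
Context (S : oriented_surface R).
Implicit Types (F X : S -> 'rV[R]_3) (x : R * R).

Lemma cahn_hoffmanP F p : cahn_hoffman T F p = 0 \/
  wulff_shape T (cahn_hoffman T F p) /\
  outward_unit_normal T (cahn_hoffman T F p) (unit_normal F p).
Proof. by rewrite /cahn_hoffman; case: xgetP => [w _|_]; [right|left]. Qed.

Lemma cahn_hoffman_scale (s : R) F F' p : s ^+ 2 = 1 ->
  unit_normal F' p = s *: unit_normal F p ->
  cahn_hoffman T F' p = s *: cahn_hoffman T F p.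
Proof.
move=> /eqP; rewrite sqrf_eq1 /cahn_hoffman => /orP[]/eqP -> ->.
  by rewrite !scale1r.
by rewrite !scaleN1r xget_outward_unit_normalN.
Qed.

(** The definition admits eigenvectors in any chart at the point. The differential of the transition
    carries them to the k-th chart and preserves their linear independence. *)
Lemma anisotropic_principal_curvatures_patch F k x :
  immersion F -> dom S k x ->
  (forall j z, dom S j z -> differentiable (cahn_hoffman T F \o param S j) z) ->
  let y := F \o param S k in let eta := cahn_hoffman T F \o param S k in
  anisotropic_principal_curvatures T F (param S k x) =
  xget (0, 0) [set l | generalized_eigenvalues (du y x) (dv y x)
                         (du eta x) (dv eta x) l].
Proof.
move=> Fimm kx deta y eta; congr (xget _ _).
have dF j z : dom S j z -> differentiable (F \o param S j) z.
  by move=> jz; have [] := immersed_patch_differentiable (Fimm j) jz.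
have yE (e : R * R) := diff_coords e (dF k x kx).
have etaE (e : R * R) := diff_coords e (deta k x kx).
have key (a b p q : 'rV[R]_3) (D D' : R * R -> 'rV[R]_3) (u : R * R -> R * R) l e1 e2 :
    (forall e, D e = (u e).1 *: a + (u e).2 *: b) ->
    (forall e, D' e = (u e).1 *: p + (u e).2 *: q) ->
    det2 (u e1) (u e2) != 0 -> D' e1 = - l.1 *: D e1 -> D' e2 = - l.2 *: D e2 ->
    generalized_eigenvalues a b p q l.
  by move=> DE DE' u0; rewrite !DE !DE' => E1 E2; exists (u e1), (u e2).
have key' (a b p q : 'rV[R]_3) (D D' : R * R -> 'rV[R]_3) l :
    (forall e, D e = e.1 *: a + e.2 *: b) -> (forall e, D' e = e.1 *: p + e.2 *: q) ->
    generalized_eigenvalues a b p q l -> exists e1 e2,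
    [/\ det2 e1 e2 != 0, D' e1 = - l.1 *: D e1 & D' e2 = - l.2 *: D e2].
  move=> DE DE' [e1 [e2 [e0 E1 E2]]]; exists e1, e2; split=> //.
    by rewrite DE DE'.
  by rewrite DE DE'.
apply/seteqP; split=> l /=.
  move=> [j [z [jz zx [e1 [e2 [e0 E1 E2]]]]]].
  have kz : (param S k @` dom S k) (param S j z) by exists x.
  have tz : (@Defs.coord R S k \o param S j) z = x by rewrite /= zx paramK.
  have yC e := @diff_chart_change R S k j z jz kz F e (dF j z jz).
  have etaC e := @diff_chart_change R S k j z jz kz (cahn_hoffman T F) e (deta j z jz).
  rewrite tz in yC etaC.
  apply: (key _ _ _ _ _ _ _ l e1 e2 _ _ (det2_transition_neq0 jz kz e0) E1 E2) => e.
    apply: etrans (yC e (dF k x kx)) _.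
    exact: (yE ('d (@Defs.coord R S k \o param S j) z e)).
  apply: etrans (etaC e (deta k x kx)) _.
  exact: (etaE ('d (@Defs.coord R S k \o param S j) z e)).
by move=> /(key' _ _ _ _ _ _ l yE etaE) h; exists k, x.
Qed.

Section Parallel.
Variables (X : S -> 'rV[R]_3) (t : R).
Hypotheses (t0 : t != 0) (X_imm : immersion X).
Hypothesis (Xt_imm : immersion (parallel_surface T X t)).
Let xi := cahn_hoffman T X.
Let Xt := parallel_surface T X t.

Lemma parallel_surface_patch k :
  Xt \o param S k = (X \o param S k) + t *: (xi \o param S k).
Proof. by apply: funext. Qed.

Lemma cahn_hoffman_differentiable k x : dom S k x ->
  differentiable (xi \o param S k) x.
Proof.
move=> kx.
have [dX _ _] := immersed_patch_differentiable (X_imm k) kx.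
have [dXt _ _] := immersed_patch_differentiable (Xt_imm k) kx.
have -> : xi \o param S k = t^-1 *: ((Xt \o param S k) - (X \o param S k)).
  by rewrite parallel_surface_patch [_ + t *: _]addrC addrK scalerA mulVf ?scale1r.
exact: differentiableZ (differentiableB dXt dX).
Qed.

Lemma derive_parallel_surface k x (v : R * R) : dom S k x ->
  'D_v (Xt \o param S k) x = 'D_v (X \o param S k) x + t *: 'D_v (xi \o param S k) x.
Proof.
move=> kx; have dxi := cahn_hoffman_differentiable kx.
have [dX _ _] := immersed_patch_differentiable (X_imm k) kx.
have [_ E] : is_derive x v ((X \o param S k) + t *: (xi \o param S k))
    ('D_v (X \o param S k) x + t *: 'D_v (xi \o param S k) x).
  apply: is_deriveD; first exact/derivableP/diff_derivable.
  by apply: is_deriveZ; exact/derivableP/diff_derivable.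
by rewrite parallel_surface_patch E.
Qed.

(** The field takes values in W, or is 0 by default, and the tangent plane of W at its value has the
    same normal as [X]. *)
Lemma cahn_hoffman_perp k x (v : R * R) : dom S k x ->
  dot (patch_normal (X \o param S k) x) ('D_v (xi \o param S k) x) = 0.
Proof.
move=> kx; have dxi := cahn_hoffman_differentiable kx.
rewrite deriveE //; apply: (diff_wulff_perp v T_norm W_smooth dxi).
  by move=> z; case: (cahn_hoffmanP X (param S k z)) => [|[]]; [left|right].
rewrite -unit_normal_patch //.
by case: (cahn_hoffmanP X (param S k x)) => [//|[]].
Qed.

(** The partial derivatives of [Xt] are tangent to [X] because those of [xi] are, so
    [patch_normal_sign] applies. One sign on a whole neighbourhood allows the identity to be
    differentiated. *)
Lemma cahn_hoffman_parallel k x : dom S k x -> exists2 s : R, s ^+ 2 = 1 &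
  \forall z \near x,
    (s *: (xi \o param S k)) z = (cahn_hoffman T Xt \o param S k) z.
Proof.
move=> kx.
have perp z (v : R * R) : dom S k z ->
    dot (cross (du (X \o param S k) z) (dv (X \o param S k) z))
        ('D_v (xi \o param S k) z) = 0.
  move=> kz; have := cahn_hoffman_perp v kz.
  have := dot_normalizer_gt0 (immersed_patch_cross (X_imm k) kz).
  rewrite -[patch_normal _ _]/(normalize (cross (du _ _) (dv _ _))).
  move: (cross _ _) ('D_v _ _) => c w; rewrite /normalize dotZr dotZl => c0 /eqP.
  rewrite mulf_eq0 => /orP[/eqP k0|/eqP //]; by rewrite k0 mul0r ltxx in c0.
have [|s s1 near_s] := patch_normal_sign (@dom_open R S k) (X_imm k) (Xt_imm k) kx.
  move=> z kz; have pu := perp z (1, 0) kz; have pv := perp z (0, 1) kz.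
  have Eu := derive_parallel_surface (1, 0) kz.
  have Ev := derive_parallel_surface (0, 1) kz.
  have aux (c a p q : 'rV[R]_3) : q = a + t *: p -> dot c a = 0 -> dot c p = 0 ->
    dot c q = 0 by move=> -> ca cp; rewrite dotDr dotZr ca cp mulr0 addr0.
  split.
    exact: (aux _ _ _ _ Eu (dot_crossl _ _) pu).
  exact: (aux _ _ _ _ Ev (dot_crossr _ _) pv).
exists s => //; apply: filterS near_s => z [kz nz].
rewrite [RHS](_ : _ = s *: xi (param S k z)) //.
by apply: cahn_hoffman_scale => //; rewrite !unit_normal_patch.
Qed.

Lemma cahn_hoffman_parallel_differentiable k x : dom S k x ->
  differentiable (cahn_hoffman T Xt \o param S k) x.
Proof.
move=> kx; have [s _ E] := cahn_hoffman_parallel kx.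
apply: near_eq_differentiable E _.
exact/differentiableZ/cahn_hoffman_differentiable.
Qed.

Lemma derive_cahn_hoffman_parallel k x : dom S k x -> exists2 s : R, s ^+ 2 = 1 &
  forall v : R * R, 'D_v (cahn_hoffman T Xt \o param S k) x =
                    s *: 'D_v (xi \o param S k) x.
Proof.
move=> kx; have [s s1 E] := cahn_hoffman_parallel kx; exists s => // v.
have dxi := cahn_hoffman_differentiable kx.
have [_ <-] : is_derive x v (s *: (xi \o param S k)) (s *: 'D_v (xi \o param S k) x).
  by apply: is_deriveZ; exact/derivableP/diff_derivable.
by apply: esym; exact: near_eq_derive.
Qed.

Lemma laguerre_integrand_parallel k x : dom S k x ->
  let l := anisotropic_principal_curvatures T X (param S k x) in
  let m := anisotropic_principal_curvatures T Xt (param S k x) in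
  ((m.1)^-1 - (m.2)^-1) ^+ 2 * area_density (cahn_hoffman T Xt \o param S k) x =
  ((l.1)^-1 - (l.2)^-1) ^+ 2 * area_density (xi \o param S k) x.
Proof.
move=> kx; have [s s1 dE] := derive_cahn_hoffman_parallel kx.
have pE := dE (1, 0); have qE := dE (0, 1).
have aE := derive_parallel_surface (1, 0) kx.
have bE := derive_parallel_surface (0, 1) kx.
have ab0 := immersed_patch_cross (X_imm k) kx.
have abt0 := immersed_patch_cross (Xt_imm k) kx.
have AE : area_density (cahn_hoffman T Xt \o param S k) x =
    area_density (xi \o param S k) x := area_density_scale s1 pE qE.
have mul_eq (u v d d' : R) : d' = d -> d = 0 \/ u = v -> u * d' = v * d.
  by move=> -> [->|->]; rewrite ?mulr0.
apply: mul_eq AE _.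
(* Where the differential of [xi] degenerates, the area density is 0 and both products vanish
   whatever the curvatures are. *)
have [pq0|pq0] := eqVneq (cross (du (xi \o param S k) x) (dv (xi \o param S k) x)) 0.
  by left; exact: area_density_degenerate pq0.
right.
have lE := anisotropic_principal_curvatures_patch X_imm kx cahn_hoffman_differentiable.
have mE := anisotropic_principal_curvatures_patch Xt_imm kx
  cahn_hoffman_parallel_differentiable.
have aux (a b p q a' b' p' q' : 'rV[R]_3) :
    p' = s *: p -> q' = s *: q -> a' = a + t *: p -> b' = b + t *: q ->
    cross a b != 0 -> cross a' b' != 0 -> cross p q != 0 ->
    forall l m, l = xget (0, 0) [set l | generalized_eigenvalues a b p q l] ->
    m = xget (0, 0) [set m | generalized_eigenvalues a' b' p' q' m] ->
    ((m.1)^-1 - (m.2)^-1) ^+ 2 = ((l.1)^-1 - (l.2)^-1) ^+ 2.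
  move=> -> -> -> -> ? ? ? l m -> ->; exact: laguerre_density_parallel.
exact: (aux _ _ _ _ _ _ _ _ pE qE aE bE ab0 abt0 pq0 _ _ lE mE).
Qed.

End Parallel.

End Laguerre.

Theorem mainTheorem3 (R : realType) (T : 'rV[R]_3 -> R)
    (T_norm : is_norm T)
    (W_smooth : smooth_surface (wulff_shape T))
    (W_curved : positive_curvature (wulff_shape T))
    (S : oriented_surface R) (X : S -> 'rV[R]_3)
    (X_immersion : immersion X)
    (X_curved : nonvanishing_gauss_curvature X)
    (t : R) (Xt_immersion : immersion (parallel_surface T X t)) :
  laguerre T (parallel_surface T X t) = laguerre T X.
Proof.
(* The case t = 0 is separate because the regularity of the Cahn-Hoffman field is obtained by
   dividing by [t]. *)
have [t0|t0] := eqVneq t 0.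
  by congr (laguerre T); apply: funext => p; rewrite /parallel_surface t0 scale0r addr0.
apply: (congr1 (fun z => (4^-1)%:E * z)%E); rewrite /area_integral.
(* Both functionals integrate over the same pieces of the same charts, so pointwise equality of the
   integrands suffices. *)
apply: eq_eseriesr => k _; apply: eq_integral => x; rewrite inE => -[kx _].
apply: (congr1 EFin).
exact: (laguerre_integrand_parallel T_norm W_smooth W_curved t0 X_immersion
  Xt_immersion kx).
Qed.
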